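(* Let $m\in\mathbb{N}$. The family $\mathscr{F}_m=\{\mathcal{T}_{\mathbf{k}}\}_{\mathbf{k}\in\mathbb{N}^2,|\mathbf{k}|=m}$ is a basis of the right $\mathbb{H}$-module $U_m$. Namely, for every $P\in U_m$ and all $x\in\mathbb{H}$, $$P(x)=\sum_{|\mathbf{k}|=m}\mathcal{T}_{\mathbf{k}}(x)\,c_{\mathbf{k}},\qquad c_{\mathbf{k}}:=\frac{1}{\mathbf{k}!}\,\delta^{(0,\mathbf{k})}P(0)\,.$$ Moreover, $P$ is $(1,3)$-slice preserving under the following assumptions on $c_{\mathbf{k}}$, valid for all $\mathbf{k}=(k_1,k_2)\in\mathbb{N}^2$ with $|\mathbf{k}|=m$: $c_{\mathbf{k}}\in\mathbb{C}$ when $k_2=0$; $c_{\mathbf{k}}\in\mathbb{R}$ when either $k_1=0\neq k_2$, or $k_1\neq0\neq k_2$ and $k_2\in2\mathbb{N}$; $c_{\mathbf{k}}=0$ when $k_1\neq0$ and $k_2\in2\mathbb{N}+1$.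
   Context: $\mathbb{N}=\{0,1,2,\ldots\}$. $\mathbb{H}=\mathbb{R}+i\mathbb{R}+j\mathbb{R}+k\mathbb{R}$ is the algebra of real quaternions, with variable $x=x_0+ix_1+jx_2+kx_3$; $\mathbb{C}:=\mathbb{R}+i\mathbb{R}\subset\mathbb{H}$; $\mathbb{S}^1:=\{jb+kc: b,c\in\mathbb{R},\ b^2+c^2=1\}$. For $J\in\mathbb{S}^1$, $\mathbb{R}^{2+1}_J:=\mathrm{Span}_{\mathbb{R}}(1,i,J)$, with points written $x_0+ix_1+\beta J$ ($x_0,x_1,\beta\in\mathbb{R}$). For $V\subseteq\mathbb{R}^{2+1}_J$ open, a $C^1$ function $\phi:V\to\mathbb{H}$ is $J$-monogenic if $(\partial_{x_0}+i\partial_{x_1}+J\partial_\beta)\phi(x_0+ix_1+\beta J)\equiv0$ on $V$ (left multiplication). A domain $\Omega$ in $\mathbb{H}$ is a nonempty connected open subset; $\Omega_J:=\Omega\cap\mathbb{R}^{2+1}_J$ and, for $f:\Omega\to\mathbb{H}$, $f_J:=f|_{\Omega_J}$. The function $f$ is $(1,3)$-regular if $f_J$ is $J$-monogenic for every $J\in\mathbb{S}^1$; the set of such functions is $\mathrm{Reg}_{(1,3)}(\Omega,\mathbb{H})$, a right $\mathbb{H}$-module. A $(1,3)$-regular $f$ is $(1,3)$-slice preserving if $f(\Omega_J)\subseteq\mathbb{R}^{2+1}_J$ for all $J\in\mathbb{S}^1$. $U_m$ is the right $\mathbb{H}$-submodule of $\mathrm{Reg}_{(1,3)}(\mathbb{H},\mathbb{H})$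 of those $f$ such that $f(x_0+ix_1+jx_2+kx_3)$ is an $m$-homogeneous polynomial map in the four real variables $x_0,x_1,x_2,x_3$ (the zero map included). For $\mathbf{k}=(k_1,k_2)\in\mathbb{Z}^2$, $|\mathbf{k}|:=k_1+k_2$, and for $\mathbf{k}\in\mathbb{N}^2$, $\mathbf{k}!:=k_1!\,k_2!$. The functions $\mathcal{T}_{\mathbf{k}}:\mathbb{H}\to\mathbb{H}$ are defined by: $\mathcal{T}_{\mathbf{k}}\equiv0$ if $k_1<0$ or $k_2<0$; $\mathcal{T}_{(0,0)}\equiv1$; and, for $\mathbf{k}\in\mathbb{N}^2\setminus\{(0,0)\}$, $$|\mathbf{k}|\,\mathcal{T}_{\mathbf{k}}(x):=k_1\mathcal{T}_{(k_1-1,k_2)}(x)\,(x_1-(-1)^{k_2}ix_0)+k_2\mathcal{T}_{(k_1,k_2-1)}(x)\,(x_0+jx_2+kx_3)\,.$$ Writing $\partial_0=\partial_{x_0}$, $\partial_1=\partial_{x_1}$, with $i$ acting by left multiplication, for $t,k_1\in\mathbb{N}$: $\delta^{(0,k_1,2t)}:=\partial_1^{k_1}(\partial_0^2+\partial_1^2)^t$ and $\delta^{(0,k_1,2t+1)}:=\partial_1^{k_1}(\partial_0^2+\partial_1^2)^t(\partial_0+i\partial_1)$; and $\delta^{(0,\mathbf{k})}:=\delta^{(0,k_1,k_2)}$. *)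

(* Defs.v *)
From HB Require Import structures.
From mathcomp Require Import all_boot all_order all_algebra.
From mathcomp Require Import all_classical all_reals all_analysis.
From mathcomp Require Import ring.
Set Implicit Arguments.
Unset Strict Implicit.
Unset Printing Implicit Defensive.
Import Order.TTheory GRing.Theory Num.Theory.
Import numFieldNormedType.Exports.
Local Open Scope classical_set_scope.
Local Open Scope ring_scope.

(* Quaternions as real 4-vectors (x0, x1, x2, x3).  The normed structure is
   the one of 'rV[R]_4 (sup norm), which induces the Euclidean topology. *)
Definition quat (R : realType) := 'rV[R]_4.

HB.instance Definition _ (R : realType) := NormedModule.copy (quat R) 'rV[R]_4.

Definition quat_mk (R : realType) (a b c d : R) : quat R :=
  \row_(l < 4) [:: a; b; c; d]`_l.

Definition qcoord (R : realType) (x : quat R) (l : 'I_4) : R := x 0 l.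

Section QuatRing.
Context {R : realType}.
Implicit Types x y z : quat R.

Let o1 : 'I_4 := @Ordinal 4 1 isT.
Let o2 : 'I_4 := @Ordinal 4 2 isT.
Let o3 : 'I_4 := @Ordinal 4 3 isT.

Definition quat_one : quat R := quat_mk 1 0 0 0.

Definition quat_mul x y : quat R :=
  let: (a0, a1, a2, a3) := (qcoord x ord0, qcoord x o1, qcoord x o2, qcoord x o3) in
  let: (b0, b1, b2, b3) := (qcoord y ord0, qcoord y o1, qcoord y o2, qcoord y o3) in
  quat_mk (a0 * b0 - a1 * b1 - a2 * b2 - a3 * b3)
          (a0 * b1 + a1 * b0 + a2 * b3 - a3 * b2)
          (a0 * b2 - a1 * b3 + a2 * b0 + a3 * b1)
          (a0 * b3 + a1 * b2 - a2 * b1 + a3 * b0).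

Lemma quatP x y :
  x 0 ord0 = y 0 ord0 -> x 0 o1 = y 0 o1 -> x 0 o2 = y 0 o2 ->
  x 0 o3 = y 0 o3 -> x = y.
Proof.
move=> h0 h1 h2 h3; apply/rowP => -[[|[|[|[|l]]]] hl] //.
- by have -> : Ordinal hl = ord0 by apply/val_inj.
- by have -> : Ordinal hl = o1 by apply/val_inj.
- by have -> : Ordinal hl = o2 by apply/val_inj.
- by have -> : Ordinal hl = o3 by apply/val_inj.
Qed.

Lemma quat_mulA : associative quat_mul.
Proof. by move=> x y z; apply: quatP; rewrite /quat_mul /qcoord !mxE /=; ring. Qed.

Lemma quat_mul1 : left_id quat_one quat_mul.
Proof. by move=> x; apply: quatP; rewrite /quat_mul /qcoord !mxE /=; ring. Qed.

Lemma quat_1mul : right_id quat_one quat_mul.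
Proof. by move=> x; apply: quatP; rewrite /quat_mul /qcoord !mxE /=; ring. Qed.

Lemma quat_mulDl : left_distributive quat_mul +%R.
Proof. by move=> x y z; apply: quatP; rewrite /quat_mul /qcoord !mxE /=; ring. Qed.

Lemma quat_mulDr : right_distributive quat_mul +%R.
Proof. by move=> x y z; apply: quatP; rewrite /quat_mul /qcoord !mxE /=; ring. Qed.

Lemma quat_one_neq0 : quat_one != 0.
Proof.
apply/eqP => /rowP /(_ ord0); rewrite !mxE /= => /eqP.
by rewrite oner_eq0.
Qed.

HB.instance Definition _ := GRing.Zmodule_isNzRing.Build (quat R)
  quat_mulA quat_mul1 quat_1mul quat_mulDl quat_mulDr quat_one_neq0.

Lemma quat_scaleAl (a : R) x y : a *: (x * y) = (a *: x) * y.
Proof.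
by apply: quatP; rewrite /GRing.mul /= /quat_mul /qcoord !mxE /=; ring.
Qed.

HB.instance Definition _ := GRing.Lmodule_isLalgebra.Build R (quat R) quat_scaleAl.

Lemma quat_scaleAr (a : R) x y : a *: (x * y) = x * (a *: y).
Proof.
by apply: quatP; rewrite /GRing.mul /= /quat_mul /qcoord !mxE /=; ring.
Qed.

HB.instance Definition _ := GRing.Lalgebra_isAlgebra.Build R (quat R) quat_scaleAr.

End QuatRing.

Definition qi (R : realType) : quat R := quat_mk 0 1 0 0.
Definition qj (R : realType) : quat R := quat_mk 0 0 1 0.
Definition qk (R : realType) : quat R := quat_mk 0 0 0 1.
Arguments qi {R}.
Arguments qj {R}.
Arguments qk {R}.

Definition qx0 (R : realType) (x : quat R) : R := qcoord x (@Ordinal 4 0 isT).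
Definition qx1 (R : realType) (x : quat R) : R := qcoord x (@Ordinal 4 1 isT).
Definition qx2 (R : realType) (x : quat R) : R := qcoord x (@Ordinal 4 2 isT).
Definition qx3 (R : realType) (x : quat R) : R := qcoord x (@Ordinal 4 3 isT).

Lemma quat_relations (R : realType) :
  [/\ qi * qi = -1 :> quat R, qj * qj = -1 :> quat R, qk * qk = -1 :> quat R
    & qi * qj * qk = -1 :> quat R].
Proof.
by split; apply: quatP; rewrite /GRing.mul /GRing.one /= /quat_mul /qcoord !mxE /=; ring.
Qed.

Lemma quat_decomp (R : realType) (x : quat R) :
  x = (qx0 x)%:A + qx1 x *: qi + qx2 x *: qj + qx3 x *: qk.
Proof.
by apply: quatP; rewrite /qx0 /qx1 /qx2 /qx3 /qcoord /GRing.one /= !mxE /=;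
  rewrite ?mulr1 ?mulr0 ?addr0 ?add0r //; congr (x _ _); apply/val_inj.
Qed.

Definition real_line (R : realType) : set (quat R) :=
  [set x | exists a : R, x = a%:A].

Definition complex_plane (R : realType) : set (quat R) :=
  [set x | exists a b : R, x = a%:A + b *: qi].

Definition sphere1 (R : realType) : set (quat R) :=
  [set J | exists b c : R, b ^+ 2 + c ^+ 2 = 1 /\ J = b *: qj + c *: qk].

Definition span1iJ (R : realType) (J : quat R) : set (quat R) :=
  [set x | exists a b beta : R, x = a%:A + b *: qi + beta *: J].

(* phi is J-monogenic on V, for V a relatively open subset of span1iJ J.
   At the points of V, the partial derivatives with respect to the coordinates
   of a + b i + beta J are the derivatives in the directions 1, i and J; they
   only involve the values of phi on V.  C^1 is spelled out as existence and
   continuity on V of these three partial derivatives. *)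
Definition monogenic (R : realType) (J : quat R) (V : set (quat R))
    (phi : quat R -> quat R) : Prop :=
  (forall v : quat R, [\/ v = 1, v = qi | v = J] ->
     (forall x, V x -> derivable phi x v) /\
     {within V, continuous ('D_v phi)}) /\
  (forall x, V x -> 'D_1 phi x + qi * 'D_qi phi x + J * 'D_J phi x = 0).

Definition regular13 (R : realType) (Omega : set (quat R))
    (f : quat R -> quat R) : Prop :=
  forall J, sphere1 J -> monogenic J (Omega `&` span1iJ J) f.

Definition slice_preserving13 (R : realType) (Omega : set (quat R))
    (f : quat R -> quat R) : Prop :=
  regular13 Omega f /\
  forall J, sphere1 J -> f @` (Omega `&` span1iJ J) `<=` span1iJ J.

(* The exponents of a monomial of degree m in 4 variables are all at most m. *)
Definition homogeneous_poly_map (R : realType) (m : nat)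
    (f : quat R -> quat R) : Prop :=
  exists a : {ffun 'I_4 -> 'I_m.+1} -> quat R,
    forall x, f x = \sum_(al : {ffun 'I_4 -> 'I_m.+1} | (\sum_l al l)%N == m)
                      (\prod_l qcoord x l ^+ al l) *: a al.

Definition Umod (R : realType) (m : nat) : set (quat R -> quat R) :=
  [set f | regular13 setT f /\ homogeneous_poly_map m f].

Definition right_submodule (R : realType) (M : set (quat R -> quat R)) : Prop :=
  [/\ M (fun=> 0),
      forall f g, M f -> M g -> M (fun x => f x + g x)
    & forall f c, M f -> M (fun x => f x * c)].

Definition right_basis (R : realType) (I : finType)
    (M : set (quat R -> quat R)) (e : I -> quat R -> quat R) : Prop :=
  [/\ right_submodule M,
      forall k, M (e k),
      forall c : I -> quat R,
        (forall x, \sum_k e k x * c k = 0) -> forall k, c k = 0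
    & forall f, M f -> exists c : I -> quat R, forall x, f x = \sum_k e k x * c k].

(* The functions T_k for k in N^2, by recursion on n = |k|: a summand whose
   index would become negative is 0. *)
Fixpoint Tnat (R : realType) (n k1 k2 : nat) (x : quat R) : quat R :=
  if n is n'.+1 then
    n%:R^-1 *:
      ((if k1 is k1'.+1
        then k1%:R *: (Tnat n' k1' k2 x *
                       ((qx1 x)%:A - (-1) ^+ k2 * qi * (qx0 x)%:A))
        else 0) +
       (if k2 is k2'.+1
        then k2%:R *: (Tnat n' k1 k2' x *
                       ((qx0 x)%:A + qx2 x *: qj + qx3 x *: qk))
        else 0))
  else 1.

Definition T (R : realType) (k : int * int) (x : quat R) : quat R :=
  match k with
  | (Posz k1, Posz k2) => Tnat (k1 + k2) k1 k2 x
  | _ => 0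
  end.

Lemma T_neg (R : realType) (k : int * int) (x : quat R) :
  (k.1 < 0) || (k.2 < 0) -> T k x = 0.
Proof. by case: k => -[k1|k1] [k2|k2]. Qed.

Lemma T_00 (R : realType) (x : quat R) : T (0, 0) x = 1.
Proof. by []. Qed.

Lemma T_rec (R : realType) (k1 k2 : nat) (x : quat R) :
  (k1, k2) != (0, 0)%N ->
  (k1 + k2)%:R *: T (k1%:Z, k2%:Z) x =
    k1%:R *: (T (k1%:Z - 1, k2%:Z) x *
              ((qx1 x)%:A - (-1) ^+ k2 * qi * (qx0 x)%:A)) +
    k2%:R *: (T (k1%:Z, k2%:Z - 1) x *
              ((qx0 x)%:A + qx2 x *: qj + qx3 x *: qk)).
Proof.
have predz n : n.+1%:Z - 1 = n%:Z by rewrite -addn1 PoszD addrK.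
case: k1 k2 => [|k1] [|k2] // _; rewrite ?predz ?scale0r ?add0r ?addr0.
- by rewrite /T add0n /= add0r scalerA mulfV ?pnatr_eq0 // scale1r.
- by rewrite /T !addn0 /= addr0 scalerA mulfV ?pnatr_eq0 // scale1r.
- by rewrite /T addSn /= -addSnnS scalerA mulfV ?pnatr_eq0 // scale1r.
Qed.

Definition pd0 (R : realType) (f : quat R -> quat R) : quat R -> quat R :=
  'D_1 f.
Definition pd1 (R : realType) (f : quat R -> quat R) : quat R -> quat R :=
  'D_qi f.
Definition laplace01 (R : realType) (f : quat R -> quat R) : quat R -> quat R :=
  fun x => pd0 (pd0 f) x + pd1 (pd1 f) x.
Definition dirac01 (R : realType) (f : quat R -> quat R) : quat R -> quat R :=
  fun x => pd0 f x + qi * pd1 f x.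

Definition delta0 (R : realType) (k1 k2 : nat) (f : quat R -> quat R) :
    quat R -> quat R :=
  iter k1 (@pd1 R)
    (iter k2./2 (@laplace01 R) (if odd k2 then dirac01 f else f)).

Definition index2 (m : nat) : finType :=
  {k : 'I_m.+1 * 'I_m.+1 | (k.1 + k.2 == m)%N}.
Definition ind1 (m : nat) (k : index2 m) : nat := (val k).1.
Definition ind2 (m : nat) (k : index2 m) : nat := (val k).2.

Definition Tfam (R : realType) (m : nat) (k : index2 m) : quat R -> quat R :=
  T ((ind1 k)%:Z, (ind2 k)%:Z).

Definition coefT (R : realType) (P : quat R -> quat R) (k1 k2 : nat) : quat R :=
  ((k1`! * k2`!)%N%:R)^-1 *: delta0 k1 k2 P 0.

(* Main.v *)
Require Import Defs.
From HB Require Import structures.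
From mathcomp Require Import all_boot all_order all_algebra.
From mathcomp Require Import all_classical all_reals all_analysis.
From mathcomp Require Import ring.
Set Implicit Arguments.
Unset Strict Implicit.
Unset Printing Implicit Defensive.
Import Order.TTheory GRing.Theory Num.Theory.
Import numFieldNormedType.Exports.
Local Open Scope classical_set_scope.
Local Open Scope ring_scope.

(** The three coordinates x0, x1, x2 j + x3 k enter the recursion through the
    factors z_s = x1 - s x0 i, with s = 1 or -1, and w = x0 + x2 j + x3 k.
    Replacing i by -i in the recursion gives a companion family, so T_k is
    studied together with it as a family T^s_k (Ttw), s = 1 being the original
    one.  Three differential rules, each proved by induction on |k| through the
    recursion, describe the family completely:
    - d/dx1 T^s_k = k1 T^s_(k1-1,k2)   (dirder_qi_Ttw);
    - (d/dx0 + s i d/dx1) T^s_k = k2 T^(-s)_(k1,k2-1)   (dirac_Ttw);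
    - d/dbeta T^s_k = k2 T^s_(k1,k2-1) J on the slice of J (dirder_J_Ttw).
    The second rule is the delicate one: since the values of T_k do not commute
    with i, the product rule leaves a defect, and the identity Ttw_flip, which
    compares T^s with T^(-s), is exactly what absorbs it.  On a slice one also
    has T^s J = J T^(-s), so the last two rules add up to J-monogenicity.

    The first two rules show that the operator delta^(0,k') sends T_k to a
    product of falling factorials times T_(k-k'), so that at the origin, when
    |k| = |k'|, it is k! if k = k' and 0 otherwise (delta0_Tfam).  Hence the T_k
    are independent and the coefficients of a combination are the c_k.

    It remains that an element Q of U_m killed by all the functionals
    delta^(0,k) at 0, |k| = m, vanishes (delta0_unique), by induction on m.
    The functions d/dx1 Q, and then d/dx0 Q, are in U_(m-1) and are killed by
    all the functionals there, so both vanish; monogenicity then makes the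
    derivative along J vanish on every slice, and Euler's identity
    m Q(x) = D_x Q(x) concludes.  Applied to P minus its expansion this gives
    the basis property.

    For slice preservation, Ttw_flip shows that for k2 even T_k - T^-_k is
    complex; on the slice of J the companion T^-_k is - J T_k J, and q + J q J
    is complex exactly when q lies in the span of 1, i, J. *)

(** * Polynomial maps and directional derivatives *)

(** Built from constants by additions and multiplications by coordinates, this
    class coincides with the homogeneous polynomial maps (homogeneous_polyP),
    and makes every differential identity an induction in which the only case
    with content is the product rule for a coordinate. *)
Inductive hompoly (R : realType) : nat -> (quat R -> quat R) -> Prop :=
| hompoly_cst c : hompoly 0 (fun=> c)
| hompoly_zero n : hompoly n (fun=> 0)
| hompoly_add n f g :
    hompoly n f -> hompoly n g -> hompoly n (fun x => f x + g x)
| hompoly_coord n l f : hompoly n f -> hompoly n.+1 (fun x => x 0 l *: f x).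

(** Locked, because deciding whether two derivatives match would otherwise
    unfold them down to limits. *)
HB.lock Definition dirder (R : realType) (v : quat R) (f : quat R -> quat R) :
  quat R -> quat R := 'D_v f.

Section Derivatives.
Context {R : realType}.
Implicit Types (f g : quat R -> quat R) (v w x : quat R).

Lemma is_derive_coordZ f df x v (l : 'I_4) : is_derive x v f df ->
  is_derive x v (fun y => y 0 l *: f y) (v 0 l *: f x + x 0 l *: df).
Proof.
move=> [dv dE].
have fcvg : h^-1 *: ((f \o shift x) (h *: v) - f x) @[h --> 0^'] --> df.
  by rewrite -dE.
have h0 : (h : R) @[h --> 0^'] --> (0 : R).
  by apply: cvg_trans (@cvg_id _ (nbhs (0:R))); apply: cvg_app; apply: cvg_within.
suff qcvg : h^-1 *: (((fun y : quat R => y 0 l *: f y) \o shift x) (h *: v)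
     - x 0 l *: f x) @[h --> 0^'] --> v 0 l *: f x + x 0 l *: df.
  by split; [apply/cvg_ex; exists (v 0 l *: f x + x 0 l *: df) | apply: cvg_lim].
(* The increment of y_l f(y), divided by h, is
   x_l * q_h + v_l * f x + (v_l * h) * q_h, with q_h the quotient of f; the last
   term has limit 0. *)
have -> : v 0 l *: f x + x 0 l *: df = (x 0 l *: df + v 0 l *: f x) + (v 0 l * 0) *: df.
  by rewrite mulr0 scale0r addr0 addrC.
apply: (@cvg_trans _ ((x 0 l *: (h^-1 *: ((f \o shift x) (h *: v) - f x)) + v 0 l *: f x
  + (v 0 l * h) *: (h^-1 *: ((f \o shift x) (h *: v) - f x))) @[h --> 0^'])).
  apply: near_eq_cvg; near=> h.
  have hn0 : h != 0 by near: h; exact: nbhs_dnbhs_neq.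
  rewrite /=; move: (f _) (f _) => F c.
  by apply/rowP => j; rewrite !mxE; field.
apply: cvgD; first apply: cvgD.
- by apply: cvgZ; [exact: cvg_cst|].
- exact: cvg_cst.
- by apply: cvgZ => //; apply: cvgM => //; exact: cvg_cst.
Unshelve. all: by end_near.
Qed.

Lemma hompoly_continuous n f : hompoly n f -> continuous f.
Proof.
elim=> {n f} [c|n|n f g _ fc _ gc|n l f _ fc] x.
- exact: cst_continuous.
- exact: cst_continuous.
- by apply: continuousD; [apply: fc|apply: gc].
- by apply: continuousZ; [exact: coord_continuous|exact: fc].
Qed.

Lemma hompoly_derivable n f x v : hompoly n f -> derivable f x v.
Proof.
elim=> {n f} [c|n|n f g _ fd _ gd|n l f _ fd].
- exact: derivable_cst.
- exact: derivable_cst.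
- exact: derivableD.
- by have [] := @is_derive_coordZ _ _ x v l (derivableP fd).
Qed.

Lemma dirderE v f : dirder v f = 'D_v f.
Proof. by rewrite dirder.unlock. Qed.

Lemma pd1E f : pd1 f = dirder qi f.
Proof. by rewrite dirderE. Qed.

Lemma laplace01E f :
  laplace01 f = (fun x => dirder 1 (dirder 1 f) x + dirder qi (dirder qi f) x).
Proof. by rewrite !dirderE. Qed.

Lemma dirac01E f : dirac01 f = (fun x => dirder 1 f x + qi * dirder qi f x).
Proof. by rewrite !dirderE. Qed.

Lemma dirder_cst (c : quat R) v : dirder v (fun=> c) = (fun=> 0).
Proof. by rewrite dirderE; apply/funext => x; exact: derive_cst. Qed.

Lemma dirder_add n p f g v : hompoly n f -> hompoly p g ->
  dirder v (fun x => f x + g x) = (fun x => dirder v f x + dirder v g x).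
Proof.
move=> fP gP; rewrite !dirderE; apply/funext => x.
by apply: deriveD; [exact: hompoly_derivable fP|exact: hompoly_derivable gP].
Qed.

Lemma dirder_coordZ n f v (l : 'I_4) : hompoly n f ->
  dirder v (fun x : quat R => x 0 l *: f x) =
  (fun x => v 0 l *: f x + x 0 l *: dirder v f x).
Proof.
move=> fP; rewrite !dirderE; apply/funext => x.
have fd : derivable f x v := hompoly_derivable fP.
by have [] := is_derive_coordZ l (derivableP fd).
Qed.

Lemma hompoly_scale n f (a : R) : hompoly n f -> hompoly n (fun x => a *: f x).
Proof.
elim=> {n f} [c|n|n f g _ fP _ gP|n l f _ fP].
- exact: hompoly_cst.
- rewrite (_ : (fun=> _) = fun=> 0); first exact: hompoly_zero.
  by apply/funext => x; rewrite scaler0.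
- rewrite (_ : (fun=> _) = fun x => a *: f x + a *: g x); first exact: hompoly_add.
  by apply/funext => x; rewrite scalerDr.
- rewrite (_ : (fun=> _) = fun x : quat R => x 0 l *: (a *: f x)).
    exact: hompoly_coord.
  by apply/funext => x; rewrite !scalerA mulrC.
Qed.

Lemma dirder_scale n f (a : R) v : hompoly n f ->
  dirder v (fun x => a *: f x) = (fun x => a *: dirder v f x).
Proof.
by move=> fP; rewrite !dirderE; apply/funext => x; apply: deriveZ; exact: hompoly_derivable fP.
Qed.

Lemma hompoly_mulr n f (q : quat R) :
  hompoly n f -> hompoly n (fun x => f x * q).
Proof.
elim=> {n f} [c|n|n f g _ fP _ gP|n l f _ fP].
- exact: hompoly_cst.
- rewrite (_ : (fun=> _) = fun=> 0); first exact: hompoly_zero.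
  by apply/funext => x; rewrite mul0r.
- rewrite (_ : (fun=> _) = fun x => f x * q + g x * q); first exact: hompoly_add.
  by apply/funext => x; rewrite mulrDl.
- rewrite (_ : (fun=> _) = fun x : quat R => x 0 l *: (f x * q)).
    exact: hompoly_coord.
  by apply/funext => x; rewrite scalerAl.
Qed.

Lemma dirder_mulr n f (q : quat R) v : hompoly n f ->
  dirder v (fun x => f x * q) = (fun x => dirder v f x * q).
Proof.
elim=> {n f} [c|n|n f g fP fE gP gE|n l f fP fE].
- by rewrite !dirder_cst; apply/funext => x; rewrite mul0r.
- rewrite (_ : (fun=> _) = fun=> 0); last by apply/funext => x; rewrite mul0r.
  by rewrite !dirder_cst; apply/funext => x; rewrite mul0r.
- rewrite (dirder_add v fP gP) (_ : (fun=> _) = fun x => f x * q + g x * q).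
    rewrite (dirder_add _ (hompoly_mulr q fP) (hompoly_mulr q gP)) fE gE.
    by apply/funext => x; rewrite mulrDl.
  by apply/funext => x; rewrite mulrDl.
- rewrite (dirder_coordZ v l fP).
  rewrite (_ : (fun=> _) = fun x : quat R => x 0 l *: (f x * q)).
    rewrite (dirder_coordZ _ _ (hompoly_mulr q fP)) fE.
    by apply/funext => x; rewrite mulrDl !scalerAl.
  by apply/funext => x; rewrite scalerAl.
Qed.

Lemma hompoly_mull n f (q : quat R) :
  hompoly n f -> hompoly n (fun x => q * f x).
Proof.
elim=> {n f} [c|n|n f g _ fP _ gP|n l f _ fP].
- exact: hompoly_cst.
- rewrite (_ : (fun=> _) = fun=> 0); first exact: hompoly_zero.
  by apply/funext => x; rewrite mulr0.
- rewrite (_ : (fun=> _) = fun x => q * f x + q * g x); first exact: hompoly_add.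
  by apply/funext => x; rewrite mulrDr.
- rewrite (_ : (fun=> _) = fun x : quat R => x 0 l *: (q * f x)).
    exact: hompoly_coord.
  by apply/funext => x; rewrite scalerAr.
Qed.

Lemma dirder_mull n f (q : quat R) v : hompoly n f ->
  dirder v (fun x => q * f x) = (fun x => q * dirder v f x).
Proof.
elim=> {n f} [c|n|n f g fP fE gP gE|n l f fP fE].
- by rewrite !dirder_cst; apply/funext => x; rewrite mulr0.
- rewrite (_ : (fun=> _) = fun=> 0); last by apply/funext => x; rewrite mulr0.
  by rewrite !dirder_cst; apply/funext => x; rewrite mulr0.
- rewrite (dirder_add v fP gP) (_ : (fun=> _) = fun x => q * f x + q * g x).
    rewrite (dirder_add _ (hompoly_mull q fP) (hompoly_mull q gP)) fE gE.
    by apply/funext => x; rewrite mulrDr.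
  by apply/funext => x; rewrite mulrDr.
- rewrite (dirder_coordZ v l fP).
  rewrite (_ : (fun=> _) = fun x : quat R => x 0 l *: (q * f x)).
    rewrite (dirder_coordZ _ _ (hompoly_mull q fP)) fE.
    by apply/funext => x; rewrite mulrDr !scalerAr.
  by apply/funext => x; rewrite scalerAr.
Qed.

Lemma hompoly_dirder n f v : hompoly n f -> hompoly n.-1 (dirder v f).
Proof.
move=> fP.
(* In degree 0 truncated predecessors hide that the derivative vanishes, which
   the coordinate case needs. *)
suff: hompoly n.-1 (dirder v f) /\ (n = 0%N -> dirder v f = fun=> 0) by case.
elim: fP => {n f} [c|n|n f g fP [fD f0] gP [gD g0]|n l f fP [fD f0]].
- by rewrite dirder_cst; split=> //; exact: hompoly_zero.
- by rewrite dirder_cst; split=> //; exact: hompoly_zero.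
- rewrite (dirder_add _ fP gP); split=> [|n0]; first exact: hompoly_add.
  by rewrite f0 // g0 //; apply/funext => x; rewrite addr0.
- rewrite (dirder_coordZ _ _ fP); split=> //=.
  apply: hompoly_add; first exact: hompoly_scale.
  case: n => [|n] in fP fD f0 *; last exact: hompoly_coord.
  rewrite (_ : (fun=> _) = fun=> 0); first exact: hompoly_zero.
  by apply/funext => x; rewrite f0 // scaler0.
Qed.

Lemma dirder_comm n f v w : hompoly n f ->
  dirder v (dirder w f) = dirder w (dirder v f).
Proof.
elim=> {n f} [c|n|n f g fP fE gP gE|n l f fP fE].
- by rewrite !dirder_cst.
- by rewrite !dirder_cst.
- rewrite !(dirder_add _ fP gP).
  by rewrite !(dirder_add _ (hompoly_dirder _ fP) (hompoly_dirder _ gP)) fE gE.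
- have D1 (u : quat R) : hompoly n (fun x => u 0 l *: f x) by exact: hompoly_scale.
  have D2 u := hompoly_coord l (hompoly_dirder u fP).
  rewrite !(dirder_coordZ _ _ fP) !(dirder_add _ (D1 _) (D2 _)).
  rewrite !(dirder_scale _ _ fP) !(dirder_coordZ _ _ (hompoly_dirder _ fP)) fE.
  by apply/funext => x; rewrite addrCA.
Qed.

Lemma dirder_dirD n f v w x : hompoly n f ->
  dirder (v + w) f x = dirder v f x + dirder w f x.
Proof.
elim=> {n f} [c|n|n f g fP fE gP gE|n l f fP fE].
- by rewrite !dirder_cst addr0.
- by rewrite !dirder_cst addr0.
- by rewrite !(dirder_add _ fP gP) fE gE addrACA.
- by rewrite !(dirder_coordZ _ _ fP) fE mxE scalerDl scalerDr addrACA.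
Qed.

Lemma dirder_dirZ n f (a : R) v x : hompoly n f ->
  dirder (a *: v) f x = a *: dirder v f x.
Proof.
elim=> {n f} [c|n|n f g fP fE gP gE|n l f fP fE].
- by rewrite !dirder_cst scaler0.
- by rewrite !dirder_cst scaler0.
- by rewrite !(dirder_add _ fP gP) fE gE scalerDr.
- by rewrite !(dirder_coordZ _ _ fP) fE mxE scalerDr !scalerA (mulrC a (x 0 l)).
Qed.

Lemma hompoly_euler n f x : hompoly n f -> dirder x f x = n%:R *: f x.
Proof.
elim=> {n f} [c|n|n f g fP fE gP gE|n l f fP fE].
- by rewrite dirder_cst scale0r.
- by rewrite dirder_cst scaler0.
- by rewrite (dirder_add _ fP gP) fE gE scalerDr.
- by rewrite (dirder_coordZ _ _ fP) fE -natr1 scalerDl scale1r addrC !scalerA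
     (mulrC (x 0 l)).
Qed.

(** Allows differentiating the monogenicity equation, which holds on a slice
    only, in the directions of that slice. *)
Lemma dirder_vanish (V : set (quat R)) f v x :
  (forall y, V y -> f y = 0) -> (forall h : R, V (h *: v + x)) ->
  dirder v f x = 0.
Proof.
move=> f0 xV; rewrite dirderE /derive (_ : (fun h => _) = fun=> 0).
  by apply: cvg_lim => //; exact: cvg_cst.
apply/funext => h /=; rewrite f0 //.
have := xV 0; rewrite scale0r add0r => /f0 ->.
by rewrite subr0 scaler0.
Qed.

End Derivatives.

(** * Homogeneous polynomial maps *)

Section Homogeneous.
Context {R : realType}.
Implicit Types (f g : quat R -> quat R) (x : quat R).

Lemma hompoly_ext n f g : (forall x, f x = g x) -> hompoly n f -> hompoly n g.
Proof. by move=> /funext ->. Qed.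

Lemma homogeneous_ext m f g : (forall x, f x = g x) ->
  homogeneous_poly_map m f -> homogeneous_poly_map m g.
Proof. by move=> /funext ->. Qed.

Lemma hompoly_sum n (I : Type) (r : seq I) (P : pred I) (F : I -> quat R -> quat R) :
  (forall i, P i -> hompoly n (F i)) ->
  hompoly n (fun x => \sum_(i <- r | P i) F i x).
Proof.
move=> FP; elim: r => [|i r IH].
  by apply: (hompoly_ext _ (hompoly_zero R n)) => x; rewrite big_nil.
have [Pi|nPi] := boolP (P i).
  by apply: (hompoly_ext _ (hompoly_add (FP i Pi) IH)) => x; rewrite big_cons Pi.
by apply: (hompoly_ext _ IH) => x; rewrite big_cons (negPf nPi).
Qed.

Lemma hompoly_monomial (e : 'I_4 -> nat) (r : seq 'I_4) (c : quat R) :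
  hompoly (\sum_(l <- r) e l) (fun x => (\prod_(l <- r) qcoord x l ^+ e l) *: c).
Proof.
elim: r => [|l r IH].
  rewrite big_nil; apply: (hompoly_ext _ (hompoly_cst c)) => x.
  by rewrite big_nil scale1r.
rewrite big_cons.
suff: hompoly (e l + \sum_(l <- r) e l) (fun x =>
    qcoord x l ^+ e l *: ((\prod_(l <- r) qcoord x l ^+ e l) *: c)).
  by apply: hompoly_ext => x; rewrite big_cons scalerA.
elim: (e l) => [|n IHn]; first by apply: (hompoly_ext _ IH) => x; rewrite scale1r.
by apply: (hompoly_ext _ (hompoly_coord l IHn)) => x; rewrite exprS -scalerA.
Qed.

Lemma homogeneous_zero m : homogeneous_poly_map m (fun=> 0 : quat R).
Proof. by exists (fun=> 0) => x; rewrite big1 // => al _; rewrite scaler0. Qed.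

Lemma homogeneous_add m f g : homogeneous_poly_map m f ->
  homogeneous_poly_map m g -> homogeneous_poly_map m (fun x => f x + g x).
Proof.
move=> [a fE] [b gE]; exists (fun al => a al + b al) => x.
by rewrite fE gE -big_split; apply: eq_bigr => al _; rewrite scalerDr.
Qed.

Lemma homogeneous_monomial m (e : 'I_4 -> nat) (c : quat R) :
  (\sum_l e l)%N = m ->
  homogeneous_poly_map m (fun x => (\prod_l qcoord x l ^+ e l) *: c).
Proof.
move=> em; have le l : (e l < m.+1)%N by rewrite ltnS -em (bigD1 l) //= leq_addr.
pose be := [ffun l => Ordinal (le l)] : {ffun 'I_4 -> 'I_m.+1}.
exists (fun al => if al == be then c else 0) => x.
rewrite (bigD1 be) /=; last first.
  by apply/eqP; transitivity (\sum_l e l)%N => //; apply: eq_bigr => l _; rewrite ffunE.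
rewrite eqxx [X in _ + X]big1 ?addr0; last by move=> al /andP[_ /negPf ->]; rewrite scaler0.
by congr (_ *: _); apply: eq_bigr => l _; rewrite ffunE.
Qed.

Lemma homogeneous_coord m f (l : 'I_4) : homogeneous_poly_map m f ->
  homogeneous_poly_map m.+1 (fun x : quat R => x 0 l *: f x).
Proof.
move=> [a fE]; apply: (@homogeneous_ext _ (fun x : quat R =>
    \sum_(al : {ffun 'I_4 -> 'I_m.+1} | (\sum_l al l)%N == m)
     x 0 l *: ((\prod_l qcoord x l ^+ al l) *: a al))) => [x|].
  by rewrite fE scaler_sumr.
have: forall r : seq {ffun 'I_4 -> 'I_m.+1}, homogeneous_poly_map m.+1
  (fun x : quat R => \sum_(al <- r | (\sum_l al l)%N == m)
     x 0 l *: ((\prod_l qcoord x l ^+ al l) *: a al)); last exact.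
elim=> [|al r IH].
  by apply: (homogeneous_ext _ (homogeneous_zero m.+1)) => x; rewrite big_nil.
have [alm|alm] := boolP (\sum_l al l == m)%N; last first.
  by apply: (homogeneous_ext _ IH) => x; rewrite big_cons (negPf alm).
pose e k := ((k == l) + al k)%N.
have eP : homogeneous_poly_map m.+1 (fun x => (\prod_k qcoord x k ^+ e k) *: a al).
  apply: homogeneous_monomial; rewrite big_split /= (eqP alm) (bigD1 l) //= eqxx.
  by rewrite big1 // => k /negPf ->.
apply: (homogeneous_ext _ (homogeneous_add eP IH)) => x.
rewrite big_cons alm scalerA; congr (_ *: _ + _).
rewrite (eq_bigr (fun k => qcoord x k ^+ (k == l) * qcoord x k ^+ al k)).
  rewrite big_split /= (bigD1 (P := xpredT) l) //= eqxx; congr (_ * _).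
  by rewrite big1 ?mulr1 // => k /negPf ->.
by move=> k _; rewrite exprD.
Qed.

Lemma homogeneous_polyP m f : homogeneous_poly_map m f <-> hompoly m f.
Proof.
split=> [[a fE]|].
  rewrite (funext fE); apply: hompoly_sum => al /eqP {1}<-.
  exact: hompoly_monomial.
elim=> {m f} [c|n|n f g _ fP _ gP|n l f _ fP].
- rewrite (_ : (fun=> _) = fun x => (\prod_l qcoord x l ^+ 0) *: c).
    by apply: homogeneous_monomial; rewrite big1.
  by apply/funext => x; rewrite big1 ?scale1r.
- exact: homogeneous_zero.
- exact: homogeneous_add.
- exact: homogeneous_coord.
Qed.

End Homogeneous.

(** * Quaternionic coordinates *)

Section Coordinates.
Context {R : realType}.
Implicit Types (x y : quat R) (a : R).

Lemma qxP x y : qx0 x = qx0 y -> qx1 x = qx1 y -> qx2 x = qx2 y -> qx3 x = qx3 y ->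
  x = y.
Proof.
move=> h0 h1 h2 h3; apply: quatP => //.
by rewrite (_ : ord0 = @Ordinal 4 0 isT) //; apply/val_inj.
Qed.

Lemma qxD x y : ((qx0 (x + y) = qx0 x + qx0 y)%R * (qx1 (x + y) = qx1 x + qx1 y)%R *
  (qx2 (x + y) = qx2 x + qx2 y)%R * (qx3 (x + y) = qx3 x + qx3 y)%R)%type.
Proof. by rewrite /qx0 /qx1 /qx2 /qx3 /qcoord !mxE. Qed.

Lemma qxN x : ((qx0 (- x) = - qx0 x)%R * (qx1 (- x) = - qx1 x)%R *
  (qx2 (- x) = - qx2 x)%R * (qx3 (- x) = - qx3 x)%R)%type.
Proof. by rewrite /qx0 /qx1 /qx2 /qx3 /qcoord !mxE. Qed.

Lemma qxZ a x : ((qx0 (a *: x) = a * qx0 x)%R * (qx1 (a *: x) = a * qx1 x)%R *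
  (qx2 (a *: x) = a * qx2 x)%R * (qx3 (a *: x) = a * qx3 x)%R)%type.
Proof. by rewrite /qx0 /qx1 /qx2 /qx3 /qcoord !mxE. Qed.

Lemma qxM x y :
  ((qx0 (x * y) = qx0 x * qx0 y - qx1 x * qx1 y - qx2 x * qx2 y - qx3 x * qx3 y)%R *
   (qx1 (x * y) = qx0 x * qx1 y + qx1 x * qx0 y + qx2 x * qx3 y - qx3 x * qx2 y)%R *
   (qx2 (x * y) = qx0 x * qx2 y - qx1 x * qx3 y + qx2 x * qx0 y + qx3 x * qx1 y)%R *
   (qx3 (x * y) = qx0 x * qx3 y + qx1 x * qx2 y - qx2 x * qx1 y + qx3 x * qx0 y)%R)%type.
Proof.
have o0 : ord0 = @Ordinal 4 0 isT by apply/val_inj.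
have mE : x * y = quat_mul x y by [].
by rewrite mE /qx0 /qx1 /qx2 /qx3 /quat_mul o0 /qcoord !mxE.
Qed.

Lemma qx_cst :
  ((qx0 (0 : quat R) = 0)%R * (qx1 (0 : quat R) = 0)%R *
   (qx2 (0 : quat R) = 0)%R * (qx3 (0 : quat R) = 0)%R *
   ((qx0 (1 : quat R) = 1)%R * (qx1 (1 : quat R) = 0)%R *
    (qx2 (1 : quat R) = 0)%R * (qx3 (1 : quat R) = 0)%R) *
   ((qx0 (@qi R) = 0)%R * (qx1 (@qi R) = 1)%R * (qx2 (@qi R) = 0)%R * (qx3 (@qi R) = 0)%R) *
   ((qx0 (@qj R) = 0)%R * (qx1 (@qj R) = 0)%R * (qx2 (@qj R) = 1)%R * (qx3 (@qj R) = 0)%R) *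
   ((qx0 (@qk R) = 0)%R * (qx1 (@qk R) = 0)%R * (qx2 (@qk R) = 0)%R * (qx3 (@qk R) = 1)%R))%type.
Proof.
have one : 1 = quat_mk 1 0 0 0 :> quat R by [].
by rewrite one /qx0 /qx1 /qx2 /qx3 /qcoord !mxE.
Qed.

Definition qxE := (qxD, qxN, qxZ, qxM, qx_cst).

End Coordinates.

Ltac quat_ring := apply: qxP; rewrite !qxE; ring.

(** * The functions T_k and their companions *)

Section Tfunctions.
Context {R : realType}.
Implicit Types (f g : quat R -> quat R) (x v J : quat R) (s : R).

Definition zvar s x : quat R := (qx1 x)%:A - (s * qx0 x) *: qi.
Definition wvar x : quat R := (qx0 x)%:A + qx2 x *: qj + qx3 x *: qk.

Lemma zvarE s x : ((qx0 (zvar s x) = qx1 x)%R * (qx1 (zvar s x) = - (s * qx0 x))%R *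
  (qx2 (zvar s x) = 0)%R * (qx3 (zvar s x) = 0)%R)%type.
Proof. by rewrite /zvar !qxE !mulr0 !mulr1 !oppr0 !addr0 !add0r. Qed.

Lemma wvarE x : ((qx0 (wvar x) = qx0 x)%R * (qx1 (wvar x) = 0)%R *
  (qx2 (wvar x) = qx2 x)%R * (qx3 (wvar x) = qx3 x)%R)%type.
Proof. by rewrite /wvar !qxE !mulr0 !mulr1 !addr0 !add0r. Qed.

Lemma hompoly_qx0 n f : hompoly n f -> hompoly n.+1 (fun x => qx0 x *: f x).
Proof. exact: hompoly_coord. Qed.

Lemma dirder_qx0 n f v : hompoly n f ->
  dirder v (fun x => qx0 x *: f x) = (fun x => qx0 v *: f x + qx0 x *: dirder v f x).
Proof. exact: dirder_coordZ. Qed.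

Lemma hompoly_qx1 n f : hompoly n f -> hompoly n.+1 (fun x => qx1 x *: f x).
Proof. exact: hompoly_coord. Qed.

Lemma dirder_qx1 n f v : hompoly n f ->
  dirder v (fun x => qx1 x *: f x) = (fun x => qx1 v *: f x + qx1 x *: dirder v f x).
Proof. exact: dirder_coordZ. Qed.

Lemma hompoly_qx2 n f : hompoly n f -> hompoly n.+1 (fun x => qx2 x *: f x).
Proof. exact: hompoly_coord. Qed.

Lemma dirder_qx2 n f v : hompoly n f ->
  dirder v (fun x => qx2 x *: f x) = (fun x => qx2 v *: f x + qx2 x *: dirder v f x).
Proof. exact: dirder_coordZ. Qed.

Lemma hompoly_qx3 n f : hompoly n f -> hompoly n.+1 (fun x => qx3 x *: f x).
Proof. exact: hompoly_coord. Qed.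

Lemma dirder_qx3 n f v : hompoly n f ->
  dirder v (fun x => qx3 x *: f x) = (fun x => qx3 v *: f x + qx3 x *: dirder v f x).
Proof. exact: dirder_coordZ. Qed.

Lemma mul_zvarE s f : (fun x => f x * zvar s x) =
  (fun x => qx1 x *: f x + qx0 x *: (f x * (- s *: qi))).
Proof.
apply/funext => x; rewrite /zvar mulrBr -scalerAr mulr1 -!scalerAr scalerA.
by rewrite mulrN scaleNr mulrC.
Qed.

Lemma mul_wvarE f : (fun x => f x * wvar x) =
  (fun x => (qx0 x *: f x + qx2 x *: (f x * qj)) + qx3 x *: (f x * qk)).
Proof. by apply/funext => x; rewrite /wvar !mulrDr -!scalerAr mulr1. Qed.

Lemma hompoly_mul_zvar s n f : hompoly n f -> hompoly n.+1 (fun x => f x * zvar s x).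
Proof.
move=> fP; rewrite mul_zvarE; apply: hompoly_add; first exact: hompoly_qx1.
by apply: hompoly_qx0; exact: hompoly_mulr.
Qed.

Lemma hompoly_mul_wvar n f : hompoly n f -> hompoly n.+1 (fun x => f x * wvar x).
Proof.
move=> fP; rewrite mul_wvarE; apply: hompoly_add; first apply: hompoly_add.
- exact: hompoly_qx0.
- by apply: hompoly_qx2; exact: hompoly_mulr.
- by apply: hompoly_qx3; exact: hompoly_mulr.
Qed.

Lemma dirder_mul_zvar s n f v : hompoly n f -> dirder v (fun x => f x * zvar s x) =
  (fun x => f x * zvar s v + dirder v f x * zvar s x).
Proof.
move=> fP; have fqP := hompoly_mulr (- s *: qi) fP.
rewrite mul_zvarE (dirder_add _ (hompoly_qx1 fP) (hompoly_qx0 fqP)).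
rewrite (dirder_qx1 _ fP) (dirder_qx0 _ fqP) (dirder_mulr _ _ fP).
apply/funext => x.
have /(congr1 (@^~ v)) -> := mul_zvarE s (fun=> f x).
by have /(congr1 (@^~ x)) -> := mul_zvarE s (dirder v f); rewrite addrACA.
Qed.

Lemma dirder_mul_wvar n f v : hompoly n f -> dirder v (fun x => f x * wvar x) =
  (fun x => f x * wvar v + dirder v f x * wvar x).
Proof.
move=> fP; have jP := hompoly_mulr qj fP; have kP := hompoly_mulr qk fP.
have P2 := hompoly_add (hompoly_qx0 fP) (hompoly_qx2 jP).
rewrite mul_wvarE (dirder_add _ P2 (hompoly_qx3 kP)).
rewrite (dirder_add _ (hompoly_qx0 fP) (hompoly_qx2 jP)).
rewrite (dirder_qx0 _ fP) (dirder_qx2 _ jP) (dirder_qx3 _ kP) !(dirder_mulr _ _ fP).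
apply/funext => x.
have /(congr1 (@^~ v)) -> := mul_wvarE (fun=> f x).
have /(congr1 (@^~ x)) -> := mul_wvarE (dirder v f).
by rewrite [RHS]addrACA; congr (_ + _); rewrite addrACA.
Qed.

(** The recursion of T_k with i replaced by s i.  Predecessors are truncated:
    an index that would become negative comes with the coefficient 0. *)
Fixpoint Ttw_rec s n k1 k2 x : quat R :=
  if n is n'.+1 then
    n%:R^-1 *: (k1%:R *: (Ttw_rec s n' k1.-1 k2 x * zvar (s * (-1) ^+ k2) x) +
                k2%:R *: (Ttw_rec s n' k1 k2.-1 x * wvar x))
  else 1.

Definition Ttw s k1 k2 x := Ttw_rec s (k1 + k2) k1 k2 x.

Lemma Tnat_Ttw n k1 k2 x : Tnat n k1 k2 x = Ttw_rec 1 n k1 k2 x.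
Proof.
elim: n k1 k2 => [|n IH] k1 k2 //=; congr (_ *: (_ + _)).
  case: k1 => [|k1]; rewrite ?scale0r // -IH; congr (_ *: (_ * _)).
  rewrite /zvar mul1r; congr (_ - _).
  rewrite -scalerAr mulr1 -[in LHS]signr_odd -[in RHS]signr_odd.
  by case: odd; rewrite ?expr1 ?expr0 ?mulN1r ?mul1r ?scalerN ?scaleNr.
by case: k2 => [|k2]; rewrite ?scale0r // -IH.
Qed.

Lemma Ttw00 s x : Ttw s 0 0 x = 1. Proof. by []. Qed.

(** Keeping the factor |k| on the left avoids divisions and makes the formula
    hold for k = (0, 0) too. *)
Lemma Ttw_recE s k1 k2 x : (k1 + k2)%:R *: Ttw s k1 k2 x =
  k1%:R *: (Ttw s k1.-1 k2 x * zvar (s * (-1) ^+ k2) x) +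
  k2%:R *: (Ttw s k1 k2.-1 x * wvar x).
Proof.
case: k1 k2 => [|k1] [|k2]; rewrite /Ttw.
- by rewrite !scale0r addr0.
- by rewrite add0n /= !scale0r !add0r scalerA mulfV ?pnatr_eq0 // scale1r.
- by rewrite !addn0 /= !scale0r !addr0 scalerA mulfV ?pnatr_eq0 // scale1r.
- by rewrite addSn /= scalerA mulfV ?pnatr_eq0 // scale1r addnS.
Qed.

Lemma hompoly_Ttw s k1 k2 : hompoly (k1 + k2) (Ttw s k1 k2).
Proof.
rewrite /Ttw; move: (k1 + k2)%N => n.
elim: n k1 k2 => [|n IH] k1 k2 /=; first exact: hompoly_cst.
apply: hompoly_scale; apply: hompoly_add; apply: hompoly_scale.
  exact: hompoly_mul_zvar.
exact: hompoly_mul_wvar.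
Qed.

(** Induction on |k| along the two branches of the recursion. *)
Lemma Ttw_ind (P : nat -> nat -> Prop) :
  P 0%N 0%N ->
  (forall k1 k2, (0 < k1 + k2)%N -> ((0 < k1)%N -> P k1.-1 k2) ->
     ((0 < k2)%N -> P k1 k2.-1) -> P k1 k2) -> forall k1 k2, P k1 k2.
Proof.
move=> P0 PS k1 k2; move En: (k1 + k2)%N => n.
elim: n k1 k2 En => [|n IH] k1 k2.
  by move/eqP; rewrite addn_eq0 => /andP[/eqP -> /eqP ->].
move=> E; apply: PS; rewrite ?E //.
  by case: k1 E => // k1; rewrite addSn => -[E] _; exact: IH.
by case: k2 E => // k2; rewrite addnS => -[E] _; exact: IH.
Qed.

Lemma Ttw_cancel n (p q : quat R) : (0 < n)%N -> n%:R *: p = n%:R *: q -> p = q.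
Proof. by move=> n0; apply: scalerI; rewrite pnatr_eq0 -lt0n. Qed.

End Tfunctions.

(* Identities that hold in any algebra are normalized into linear
   combinations of noncommutative monomials, which are then compared entrywise
   as opaque atoms: this is much cheaper than multiplying out coordinates. *)
Lemma coordD (R : realType) (x y : quat R) (j : 'I_4) : (x + y) 0 j = x 0 j + y 0 j.
Proof. by rewrite mxE. Qed.
Lemma coordN (R : realType) (x : quat R) (j : 'I_4) : (- x) 0 j = - x 0 j.
Proof. by rewrite mxE. Qed.
Lemma coordZ (R : realType) (a : R) (x : quat R) (j : 'I_4) : (a *: x) 0 j = a * x 0 j.
Proof. by rewrite mxE. Qed.

Lemma quat_scale_mull (R : realType) (a : R) (x y : quat R) : (a *: x) * y = a *: (x * y).
Proof. by rewrite scalerAl. Qed.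
Lemma quat_scale_mulr (R : realType) (a : R) (x y : quat R) : x * (a *: y) = a *: (x * y).
Proof. by rewrite scalerAr. Qed.

Lemma scale_swap (R : realType) (a b : R) (x : quat R) : a *: (b *: x) = b *: (a *: x).
Proof. by rewrite !scalerA mulrC. Qed.

Definition quat_expandE (R : realType) :=
  (@mulrDl (quat R), @mulrDr (quat R), @mulNr (quat R), @mulrN (quat R),
   @scalerDr R (quat R), @scalerN R (quat R), @opprD (quat R), @opprK (quat R),
   @quat_scale_mull R, @quat_scale_mulr R, @scalerA R (quat R), @mulrA (quat R)).

Ltac mod_ring R E := rewrite !(quat_expandE R, E);
  apply/rowP => ?; rewrite !(coordD, coordN, coordZ); ring.

(** * Differential rules *)

Section Tderivatives.
Context {R : realType}.
Implicit Types (f g : quat R -> quat R) (x v J : quat R) (s : R).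

Lemma dirder_Ttw_rec v s k1 k2 x : (k1 + k2)%:R *: dirder v (Ttw s k1 k2) x =
  k1%:R *: (Ttw s k1.-1 k2 x * zvar (s * (-1) ^+ k2) v +
            dirder v (Ttw s k1.-1 k2) x * zvar (s * (-1) ^+ k2) x) +
  k2%:R *: (Ttw s k1 k2.-1 x * wvar v + dirder v (Ttw s k1 k2.-1) x * wvar x).
Proof.
have zP := hompoly_mul_zvar (s * (-1) ^+ k2) (hompoly_Ttw s k1.-1 k2).
have wP := hompoly_mul_wvar (hompoly_Ttw s k1 k2.-1).
have /funext E := Ttw_recE s k1 k2.
have := congr1 (fun f => dirder v f x) E.
rewrite (dirder_scale _ _ (hompoly_Ttw s k1 k2)) => ->.
rewrite (dirder_add _ (hompoly_scale _ zP) (hompoly_scale _ wP)).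
rewrite (dirder_scale _ _ zP) (dirder_scale _ _ wP).
by rewrite (dirder_mul_zvar _ _ (hompoly_Ttw _ _ _)) (dirder_mul_wvar _ (hompoly_Ttw _ _ _)).
Qed.

Lemma zvar_qi s : zvar s (@qi R) = 1.
Proof. by apply: qxP; rewrite zvarE !qxE ?mulr0 ?oppr0. Qed.

Lemma zvar1 s : zvar s (1 : quat R) = - s *: qi.
Proof. by apply: qxP; rewrite zvarE !qxE ?mulr0 ?mulr1 ?oppr0. Qed.

Lemma wvar_qi : wvar (@qi R) = 0.
Proof. by apply: qxP; rewrite wvarE !qxE. Qed.

Lemma wvar1 : wvar (1 : quat R) = 1.
Proof. by apply: qxP; rewrite wvarE !qxE. Qed.

Lemma dirder_qi_Ttw s k1 k2 x :
  dirder qi (Ttw s k1 k2) x = k1%:R *: Ttw s k1.-1 k2 x.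
Proof.
move: k1 k2; apply: Ttw_ind => [|k1 k2 k0 IH1 IH2].
  by rewrite (_ : Ttw s 0 0 = fun=> 1) // dirder_cst scale0r.
apply: (Ttw_cancel k0); rewrite dirder_Ttw_rec zvar_qi wvar_qi mulr1 mulr0 add0r.
have {}IH2 : k2%:R *: (dirder qi (Ttw s k1 k2.-1) x * wvar x) =
             k2%:R *: (k1%:R *: Ttw s k1.-1 k2.-1 x * wvar x).
  by case: k2 {k0 IH1} IH2 => [|k2] IH; rewrite ?scale0r // IH.
rewrite {}IH2; case: k1 k0 IH1 => [|k1] k0 IH1 /=.
  by rewrite !scale0r mul0r !scaler0 addr0.
rewrite {}IH1 //= [RHS]scalerA [_ * k1.+1%:R]mulrC -scalerA addSn.
rewrite -[(k1 + k2).+1%:R]natr1 [in RHS]scalerDl scale1r Ttw_recE.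
move: (zvar _ _) (wvar _) (Ttw _ _ _ _) (Ttw _ _ _ _) (Ttw _ _ _ _) => z w A B C.
by quat_ring.
Qed.

Lemma zvar_comm_qi s x (u : quat R) : u * zvar s x * qi = u * qi * zvar s x.
Proof. by rewrite -!mulrA; congr (_ * _); apply: qxP; rewrite !qxE; ring. Qed.

(** The source of the sign change between T^s and T^(-s): the two linear
    factors differ by an anticommutator of w with i. *)
Lemma zvar_subN s x : zvar (- s) x - s *: (qi * wvar x + wvar x * qi) = zvar s x.
Proof. by apply: qxP; rewrite !qxE; ring. Qed.

Lemma Ttw_comm_qi s k1 x : qi * Ttw s k1 0 x = Ttw s k1 0 x * qi.
Proof.
elim: k1 => [|k1 IH]; first by rewrite mulr1 mul1r.
apply: (@Ttw_cancel _ k1.+1) => //.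
have := Ttw_recE s k1.+1 0 x; rewrite addn0 scale0r addr0 /= => E.
rewrite scalerAr scalerAl E -scalerAr -scalerAl mulrA IH -!mulrA; congr (_ *: (_ * _)).
by apply: qxP; rewrite !qxE; ring.
Qed.

(** On the complex plane, where everything commutes, this says that T_k is
    real for k2 odd, and otherwise expresses its imaginary part by a T_k' with
    k2' odd.  Unlike these two facts, it extends to all quaternions in a form
    that the recursion reproduces: after multiplication by |k|, it is the sum of
    its instances at (k1 - 1, k2) and (k1, k2 - 1) and of zvar_subN. *)
Lemma Ttw_flip s k1 k2 x :
  k2%:R *: (Ttw s k1 k2.-1 x - Ttw (- s) k1 k2.-1 x) =
  - (k1%:R * s) *: (qi * Ttw s k1.-1 k2 x - (-1) ^+ k2 *: (Ttw s k1.-1 k2 x * qi)).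
Proof.
case: k2 => [|k2].
  by rewrite scale0r expr0 scale1r Ttw_comm_qi subrr scaler0.
move: k1 k2; apply: Ttw_ind => [|k1 k2 k0 IH1 IH2].
  by rewrite /= !Ttw00 subrr scaler0 mul0r oppr0 scale0r.
apply: (Ttw_cancel k0).
have sD (a b : R) (u : quat R) :
    a *: (qi * u - b *: (u * qi)) = qi * (a *: u) - b *: ((a *: u) * qi).
  by rewrite scalerBr scalerAr scale_swap scalerAl.
have {}IH2 : k2%:R *: (Ttw s k1 k2.-1 x - Ttw (- s) k1 k2.-1 x) =
  - (k1%:R * s) *: (qi * Ttw s k1.-1 k2 x - (-1) ^+ k2 *: (Ttw s k1.-1 k2 x * qi)).
  case: k2 {k0 IH1} IH2 => [|k2] IH; last exact: IH.
  by rewrite scale0r expr0 scale1r Ttw_comm_qi subrr scaler0.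
rewrite /= in IH1 *.
case: k1 k0 IH1 IH2 => [|k1] k0 IH1 IH2.
  rewrite mul0r oppr0 scale0r scaler0 scale_swap scalerBr !Ttw_recE.
  rewrite !scale0r !add0r -scalerBr -mulrBl scalerAl IH2.
  by rewrite mul0r oppr0 scale0r mul0r scaler0.
have := Ttw_recE s k1 k2.+1 x; rewrite -addSnnS => E.
rewrite [LHS]scale_swap scalerBr !Ttw_recE /= [RHS]scale_swap sD {}E.
have {}IH1 := IH1 isT; rewrite /= in IH2.
rewrite exprS mulN1r !mulrN mulNr in IH1 *.
apply/eqP; rewrite -subr_eq0; move/eqP: IH1; move/eqP: IH2.
rewrite -[k2.+1%:R]natr1.
rewrite -subr_eq0 => /eqP IH2; rewrite -subr_eq0 => /eqP IH1; apply/eqP.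
(* The two induction hypotheses enter as vanishing factors of z and w. *)
transitivity (k1.+1%:R *: (0 * zvar (- (s * (-1) ^+ k2)) x) +
              (k2%:R + 1) *: (0 * wvar x)); last by rewrite !mul0r !scaler0 addr0.
rewrite -{1}IH1 -IH2 /= -(zvar_subN (s * _)).

move: (zvar_comm_qi (- (s * (-1) ^+ k2)) x).
move: (zvar _ _) (wvar _) (Ttw _ _ _ _) (Ttw _ _ _ _) (Ttw _ _ _ _) (Ttw _ _ _ _) (Ttw _ _ _ _).
move: ((-1) ^+ k2) (k2%:R) (k1%:R) (k1.+1%:R).
move=> sg c2 c1 c z w U X' V' U' Y' zC.
by mod_ring R zC.
Qed.

End Tderivatives.

Section Tdirac.
Context {R : realType}.
Implicit Types (f g : quat R -> quat R) (x v J : quat R) (s : R).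

(** The product rule gives the recursion of the right-hand side and the extra
    terms k1 s (i T - (-1)^k2 T i) + k2 T, which Ttw_flip turns into one T^(-s). *)
Lemma dirac_Ttw s k1 k2 x :
  dirder 1 (Ttw s k1 k2) x + s *: (qi * dirder qi (Ttw s k1 k2) x) =
  k2%:R *: Ttw (- s) k1 k2.-1 x.
Proof.
move: k1 k2; apply: Ttw_ind => [|k1 k2 k0 IH1 IH2].
  by rewrite (_ : Ttw s 0 0 = fun=> 1) // !dirder_cst mulr0 scaler0 addr0 scale0r.
apply: (Ttw_cancel k0).
set d := fun k1 k2 => dirder 1 (Ttw s k1 k2) x + s *: (qi * dirder qi (Ttw s k1 k2) x).
have {}IH1 : k1%:R *: d k1.-1 k2 = k1%:R *: (k2%:R *: Ttw (- s) k1.-1 k2.-1 x).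
  by case: k1 {IH2} IH1 k0 => [|k1] IH k0; rewrite ?scale0r //; congr (_ *: _); exact: IH.
have {}IH2 : k2%:R *: d k1 k2.-1 = k2%:R *: (k2.-1%:R *: Ttw (- s) k1 k2.-2 x).
  by case: k2 {IH1} IH2 k0 => [|k2] IH k0; rewrite ?scale0r //; congr (_ *: _); exact: IH.
have flip := Ttw_flip s k1 k2 x.
(* The product rule yields the terms of the recursion, plus a defect due to the
   derivatives of the linear factors; Ttw_flip evaluates the defect. *)
have -> : (k1 + k2)%:R *: (dirder 1 (Ttw s k1 k2) x + s *: (qi * dirder qi (Ttw s k1 k2) x)) =
  (k1%:R *: d k1.-1 k2) * zvar (s * (-1) ^+ k2) x + (k2%:R *: d k1 k2.-1) * wvar x
  + (k2%:R *: Ttw s k1 k2.-1 x +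
    (k1%:R * s) *: (qi * Ttw s k1.-1 k2 x - (-1) ^+ k2 *: (Ttw s k1.-1 k2 x * qi))).
  rewrite scalerDr [(k1 + k2)%:R *: (s *: _)]scale_swap scalerAr.
  rewrite !dirder_Ttw_rec zvar_qi zvar1 wvar_qi wvar1 !mulr1 mulr0 add0r /d.
  move: (zvar _ _) (wvar _) (dirder _ _ _) (dirder _ _ _) (dirder _ _ _) (dirder _ _ _).
  move: (Ttw _ _ _ _) (Ttw _ _ _ _) => A B z w d1 d2 d3 d4.
  move: (k1%:R) (k2%:R) ((-1) ^+ k2) => c1 c2 sg.
  by mod_ring R (mulr1 B).
have -> : k2%:R *: Ttw s k1 k2.-1 x + (k1%:R * s) *:
   (qi * Ttw s k1.-1 k2 x - (-1) ^+ k2 *: (Ttw s k1.-1 k2 x * qi)) =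
   k2%:R *: Ttw (- s) k1 k2.-1 x.
  apply/eqP; rewrite -subr_eq0 addrAC -scalerBr flip scaleNr addrC subrr eqxx //.
rewrite {}IH1 {}IH2; case: k2 {flip} k0 => [|k2] k0.
  by rewrite !scale0r !scaler0 !mul0r !addr0.
rewrite [RHS]scale_swap addnS -[(k1 + k2).+1%:R]natr1 [in RHS]scalerDl scale1r Ttw_recE.
have -> : s * (-1) ^+ k2.+1 = - s * (-1) ^+ k2 by rewrite exprS mulN1r mulrN mulNr.
rewrite /=.
move: (Ttw _ _ _ _) (Ttw _ _ _ _) (Ttw _ _ _ _) (zvar _ _) (wvar _) => A B C z w.
move: (k1%:R) (k2%:R) (k2.+1%:R) => c1 c2 c.
by mod_ring R (mulr1 B).
Qed.

Lemma zvar_mulJ s x J : sphere1 J -> zvar s x * J = J * zvar (- s) x.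
Proof. by move=> [b [c [_ ->]]]; apply: qxP; rewrite !qxE; ring. Qed.

Lemma wvar_span x J : span1iJ J x -> sphere1 J ->
  exists a be : R, wvar x = a%:A + be *: J.
Proof.
move=> [a [x1 [be ->]]] [b [c [_ ->]]]; exists a, be.
by apply: qxP; rewrite !qxE; ring.
Qed.

Lemma wvar_mulJ x J : span1iJ J x -> sphere1 J -> wvar x * J = J * wvar x.
Proof.
move=> xJ /(wvar_span xJ)[a [be ->]].
by rewrite mulrDl mulrDr -!scalerAl -!scalerAr mul1r mulr1.
Qed.

Lemma zvar_J s J : sphere1 J -> zvar s J = 0.
Proof. by move=> [b [c [_ ->]]]; apply: qxP; rewrite !qxE; ring. Qed.

Lemma wvar_J J : sphere1 J -> wvar J = J.
Proof. by move=> [b [c [_ ->]]]; apply: qxP; rewrite !qxE; ring. Qed.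

Lemma sphere1_sqr J : sphere1 J -> J * J = -1.
Proof.
move=> [b [c [bc ->]]]; apply: qxP; rewrite !qxE; try ring.
by transitivity (- (b ^+ 2 + c ^+ 2)); [ring | rewrite bc].
Qed.

(** J anticommutes with i and commutes with w on its slice, so moving it across
    the recursion conjugates every i. *)
Lemma Ttw_mulJ s k1 k2 x J : sphere1 J -> span1iJ J x ->
  Ttw s k1 k2 x * J = J * Ttw (- s) k1 k2 x.
Proof.
move=> SJ xJ; move: k1 k2; apply: Ttw_ind => [|k1 k2 k0 IH1 IH2].
  by rewrite mul1r mulr1.
apply: (Ttw_cancel k0); rewrite scalerAl scalerAr !Ttw_recE.
rewrite mulrDl [RHS]mulrDr !quat_scale_mull !quat_scale_mulr -!mulrA.
rewrite (wvar_mulJ xJ SJ) (zvar_mulJ _ _ SJ) !mulrA.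
rewrite mulNr; congr (_ + _).
  by case: k1 {k0 IH2} IH1 => [|k1] IH; rewrite ?scale0r // IH.
by case: k2 {k0 IH1} IH2 => [|k2] IH; rewrite ?scale0r // IH.
Qed.

Lemma dirder_J_Ttw s k1 k2 x J : sphere1 J -> span1iJ J x ->
  dirder J (Ttw s k1 k2) x = k2%:R *: (Ttw s k1 k2.-1 x * J).
Proof.
move=> SJ xJ; move: k1 k2; apply: Ttw_ind => [|k1 k2 k0 IH1 IH2].
  by rewrite (_ : Ttw s 0 0 = fun=> 1) // dirder_cst scale0r.
apply: (Ttw_cancel k0); rewrite dirder_Ttw_rec (zvar_J _ SJ) (wvar_J SJ) mulr0 add0r.
have {}IH1 : k1%:R *: dirder J (Ttw s k1.-1 k2) x =
    k1%:R *: (k2%:R *: (Ttw s k1.-1 k2.-1 x * J)).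
  by case: k1 {IH2} IH1 k0 => [|k1] IH k0; rewrite ?scale0r //; congr (_ *: _); exact: IH.
have {}IH2 : k2%:R *: dirder J (Ttw s k1 k2.-1) x =
    k2%:R *: (k2.-1%:R *: (Ttw s k1 k2.-2 x * J)).
  by case: k2 {IH1} IH2 k0 => [|k2] IH k0; rewrite ?scale0r //; congr (_ *: _); exact: IH.
rewrite scalerDr !scalerAl {}IH1 {}IH2; case: k2 k0 => [|k2] k0.
  by rewrite !scale0r !scaler0 !mul0r !addr0.
rewrite !quat_scale_mull [RHS]scale_swap addnS -[(k1 + k2).+1%:R]natr1 [in RHS]scalerDl scale1r.
rewrite -!mulrA.
have -> : J * zvar (s * (-1) ^+ k2.+1) x = zvar (s * (-1) ^+ k2) x * J.
  by rewrite (zvar_mulJ _ _ SJ) exprS mulN1r mulrN.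
rewrite -(wvar_mulJ xJ SJ) -(quat_scale_mull (k1 + k2)%:R) Ttw_recE /=.
move: (Ttw _ _ _ _) (Ttw _ _ _ _) (Ttw _ _ _ _) (zvar _ _) (wvar _) => A B C z w.
move: (k1%:R) (k2%:R) (k2.+1%:R) => c1 c2 c.
by mod_ring R (mulr1 B).
Qed.

Lemma Ttw_monogenic k1 k2 x J : sphere1 J -> span1iJ J x ->
  dirder 1 (Ttw 1 k1 k2) x + qi * dirder qi (Ttw 1 k1 k2) x +
    J * dirder J (Ttw 1 k1 k2) x = 0.
Proof.
move=> SJ xJ; have := dirac_Ttw 1 k1 k2 x; rewrite scale1r => ->.
rewrite (dirder_J_Ttw _ _ _ SJ xJ) (Ttw_mulJ _ _ _ SJ xJ) -scalerAr mulrA.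
by rewrite (sphere1_sqr SJ) mulN1r scalerN subrr.
Qed.

(** The Laplacian factors as (d0 - s i d1) (d0 + s i d1), and the two factors
    act by dirac_Ttw on T^s and on T^(-s). *)
Lemma laplace_Ttw s k1 k2 : s * s = 1 -> laplace01 (Ttw s k1 k2) =
  (fun x => (k2 * k2.-1)%:R *: Ttw s k1 k2.-2 x).
Proof.
move=> ss; have fP := hompoly_Ttw s k1 k2; set f := Ttw s k1 k2 in fP *.
have d1 := hompoly_dirder 1 fP; have di := hompoly_dirder qi fP.
have qd := hompoly_scale s (hompoly_mull qi di).
have /funext E := dirac_Ttw s k1 k2.
apply/funext => x; have := dirac_Ttw (- s) k1 k2.-1 x.
move/(congr1 (fun u => k2%:R *: u)); rewrite opprK scalerA -natrM => <-.
rewrite scalerDr scalerA mulrC -scalerA scalerAr.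
have EP := hompoly_Ttw (- s) k1 k2.-1.
have G v : k2%:R *: dirder v (Ttw (- s) k1 k2.-1) x =
    dirder v (dirder 1 f) x + s *: (qi * dirder v (dirder qi f) x).
  have := congr1 (fun g => dirder v g x) E.
  rewrite (dirder_scale _ _ EP) => <-.
  by rewrite (dirder_add _ d1 qd) (dirder_scale _ _ (hompoly_mull qi di)) (dirder_mull _ _ di).
rewrite !G (dirder_comm qi 1 fP).
rewrite laplace01E.
move: (dirder _ _ _) (dirder _ _ _) (dirder _ _ _) => A B C.
have qq : qi * qi = -1 :> quat R by case: (quat_relations R).
rewrite mulrDr scalerDr quat_scale_mulr mulrA qq mulN1r !scaleNr !scalerN scalerA.
by rewrite ss scale1r opprK addrA addrK.
Qed.

End Tdirac.

(** * The operators delta *)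

Section Delta.
Context {R : realType}.
Implicit Types (f g : quat R -> quat R) (x v J : quat R) (s : R).

(** The derivative is additive on differentiable maps only, so linearity is
    restricted to polynomial maps, and d records the degree of the image in
    order to compose operators. *)
Definition right_linear_op (d : nat -> nat) (L : (quat R -> quat R) -> quat R -> quat R) :=
  forall n f, hompoly n f ->
  [/\ hompoly (d n) (L f),
      forall g, hompoly n g -> L (fun x => f x + g x) = (fun x => L f x + L g x)
    & forall c, L (fun x => f x * c) = (fun x => L f x * c)].

Lemma right_linear_op_id : right_linear_op id id.
Proof. by move=> n f fP; split. Qed.

Lemma right_linear_op_comp d e L M : right_linear_op d L -> right_linear_op e M ->
  right_linear_op (d \o e) (fun f => L (M f)).
Proof.
move=> HL HM n f fP; have [MfP MD MZ] := HM _ _ fP; have [LP LD LZ] := HL _ _ MfP.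
split=> [//|g gP|c]; last by rewrite MZ LZ.
by have [MgP _ _] := HM _ _ gP; rewrite MD // LD.
Qed.

Lemma right_linear_op_iter d L k : right_linear_op d L ->
  right_linear_op (iter k d) (iter k L).
Proof.
move=> HL; elim: k => [|k IH]; first exact: right_linear_op_id.
exact: right_linear_op_comp HL IH.
Qed.

Lemma right_linear_op_add d L M : right_linear_op d L -> right_linear_op d M ->
  right_linear_op d (fun f x => L f x + M f x).
Proof.
move=> HL HM n f fP; have [LP LD LZ] := HL _ _ fP; have [MP MD MZ] := HM _ _ fP.
split=> [|g gP|c]; first exact: hompoly_add.
  by rewrite LD // MD //; apply/funext => x; rewrite addrACA.
by rewrite LZ MZ; apply/funext => x; rewrite mulrDl.
Qed.

Lemma right_linear_op_mull d L q : right_linear_op d L ->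
  right_linear_op d (fun f x => q * L f x).
Proof.
move=> HL n f fP; have [LP LD LZ] := HL _ _ fP.
split=> [|g gP|c]; first exact: hompoly_mull.
  by rewrite LD //; apply/funext => x; rewrite mulrDr.
by rewrite LZ; apply/funext => x; rewrite mulrA.
Qed.

Lemma right_linear_dirder v : right_linear_op predn (dirder v).
Proof.
move=> n f fP; split=> [|g gP|c]; first exact: hompoly_dirder.
  exact: dirder_add fP gP.
exact: dirder_mulr fP.
Qed.

Lemma right_linear_laplace : right_linear_op (predn \o predn) (@laplace01 R).
Proof.
rewrite (funext laplace01E); apply: right_linear_op_add.
  exact: right_linear_op_comp (right_linear_dirder 1) (right_linear_dirder 1).
exact: right_linear_op_comp (right_linear_dirder qi) (right_linear_dirder qi).
Qed.

Lemma right_linear_dirac : right_linear_op predn (@dirac01 R).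
Proof.
rewrite (funext dirac01E); apply: right_linear_op_add (right_linear_dirder 1) _.
exact: right_linear_op_mull (right_linear_dirder qi).
Qed.

Lemma right_linear_delta0 a b : exists d, right_linear_op d (@delta0 R a b).
Proof.
have Hl := right_linear_op_iter b./2 right_linear_laplace.
have Hp := right_linear_op_iter a (right_linear_dirder qi).
rewrite -(funext (@pd1E R)) in Hp.
rewrite /delta0; case: (odd b).
  eexists; exact: right_linear_op_comp Hp (right_linear_op_comp Hl right_linear_dirac).
by eexists; exact: right_linear_op_comp Hp Hl.
Qed.

Lemma right_linear_op0 d L : right_linear_op d L -> L (fun=> 0) = (fun=> 0).
Proof.
move=> HL; have [_ _ /(_ 0)] := HL _ _ (hompoly_zero R 0).
rewrite (_ : (fun=> 0 * 0) = fun=> 0) => [->|]; apply/funext => x; exact: mulr0.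
Qed.

Lemma delta0_sum a b n (I : finType) (F : I -> quat R -> quat R) (c : I -> quat R) x :
  (forall i, hompoly n (F i)) ->
  delta0 a b (fun y => \sum_i F i y * c i) x = \sum_i delta0 a b (F i) x * c i.
Proof.
move=> FP; have [d dL] := right_linear_delta0 a b.
suff: forall r : seq I, delta0 a b (fun y => \sum_(i <- r) F i y * c i) x =
    \sum_(i <- r) delta0 a b (F i) x * c i by exact.
elim=> [|i r IH].
  rewrite big_nil (_ : (fun=> _) = fun=> 0); first by rewrite (right_linear_op0 dL).
  by apply/funext => y; rewrite big_nil.
rewrite big_cons -IH (_ : (fun=> _) = fun y => F i y * c i + \sum_(j <- r) F j y * c j);
  last by apply/funext => y; rewrite big_cons.
have [_ _ Z] := dL _ _ (FP i).
have [_ D _] := dL _ _ (hompoly_mulr (c i) (FP i)).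
rewrite D ?Z //; apply: hompoly_sum => j _; exact: hompoly_mulr.
Qed.

Lemma iter_laplace_Ttw t s (c : R) k1 k2 : s * s = 1 ->
  iter t (@laplace01 R) (fun x => c *: Ttw s k1 k2 x) =
  (fun x => (c * (k2 ^_ t.*2)%:R) *: Ttw s k1 (k2 - t.*2) x).
Proof.
move=> ss; elim: t => [|t IH]; first by rewrite subn0 ffactn0 mulr1.
rewrite iterS {}IH doubleS; set c' := c * _.
have TP := hompoly_Ttw s k1 (k2 - t.*2).
have E : laplace01 (fun x => c' *: Ttw s k1 (k2 - t.*2) x) =
    (fun x => c' *: laplace01 (Ttw s k1 (k2 - t.*2)) x).
  apply/funext => x; rewrite !laplace01E !(dirder_scale _ _ TP).
  by rewrite !(dirder_scale _ _ (hompoly_dirder _ TP)) -scalerDr.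
rewrite {}E laplace_Ttw //; apply/funext => x; rewrite scalerA !subnS; congr (_ *: _).
by rewrite /c' !ffactnSr subnS !natrM -!mulrA.
Qed.

Lemma iter_pd1_Ttw t s (c : R) k1 k2 :
  iter t (@pd1 R) (fun x => c *: Ttw s k1 k2 x) =
  (fun x => (c * (k1 ^_ t)%:R) *: Ttw s (k1 - t) k2 x).
Proof.
elim: t => [|t IH]; first by rewrite subn0 ffactn0 mulr1.
rewrite iterS {}IH; have TP := hompoly_Ttw s (k1 - t) k2.
rewrite pd1E (dirder_scale _ qi TP); apply/funext => x.
by rewrite dirder_qi_Ttw scalerA -mulrA -natrM -ffactnSr subnS.
Qed.

Lemma delta0_Ttw a b k1 k2 : delta0 a b (Ttw (1 : R) k1 k2) =
  (fun x => (k2 ^_ b * k1 ^_ a)%:R *: Ttw ((-1) ^+ odd b) (k1 - a) (k2 - b) x).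
Proof.
have scale1 (f : quat R -> quat R) : f = (fun x => 1 *: f x).
  by apply/funext => x; rewrite scale1r.
rewrite /delta0; case: (boolP (odd b)) => ob.
  have -> : dirac01 (Ttw (1 : R) k1 k2) = (fun x => k2%:R *: Ttw (-1) k1 k2.-1 x).
    by rewrite dirac01E; apply/funext => x; rewrite -dirac_Ttw scale1r.
  rewrite iter_laplace_Ttw ?mulrNN ?mulr1 // iter_pd1_Ttw; apply/funext => x.
  have -> : (k2 - b = k2.-1 - b./2.*2)%N.
    by rewrite -[in LHS](odd_double_half b) ob subnDA subn1.
  have -> : (k2 ^_ b = k2 * k2.-1 ^_ b./2.*2)%N.
    by rewrite -[in LHS](odd_double_half b) ob ffactnS.
  by rewrite expr1 -!natrM.
rewrite [Ttw 1 k1 k2]scale1 iter_laplace_Ttw ?mulr1 // iter_pd1_Ttw; apply/funext => x.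
have -> : b./2.*2 = b by rewrite -[RHS](odd_double_half b) (negPf ob).
by rewrite mul1r -natrM.
Qed.

End Delta.

(** * Uniqueness *)

Section Uniqueness.
Context {R : realType}.
Implicit Types (f g Q : quat R -> quat R) (x v J : quat R) (s : R).

Lemma regular_hompolyP n f : hompoly n f ->
  regular13 setT f <-> forall J x, sphere1 J -> span1iJ J x ->
    dirder 1 f x + qi * dirder qi f x + J * dirder J f x = 0.
Proof.
move=> fP; split=> [reg J x SJ xJ|H J SJ].
  by rewrite !dirderE; have [_] := reg J SJ; apply; split.
split=> [v _|x [_ xJ]]; last by have := H J x SJ xJ; rewrite !dirderE.
split=> [x _|]; first exact: hompoly_derivable fP.
have := hompoly_continuous (hompoly_dirder v fP); rewrite dirderE.
by move=> fc; apply: continuous_subspaceT; exact: fc.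
Qed.

Lemma regular_dirder n f v : v = 1 \/ v = qi -> hompoly n f -> regular13 setT f ->
  regular13 setT (dirder v f).
Proof.
move=> v1i fP /(regular_hompolyP fP) reg.
apply/(regular_hompolyP (hompoly_dirder v fP)) => J x SJ xJ.
pose F y := dirder 1 f y + qi * dirder qi f y + J * dirder J f y.
have d u := hompoly_dirder u fP.
have F0 : dirder v F x = 0.
  apply: (@dirder_vanish _ (span1iJ J)) => [y yJ|h]; first exact: reg.
  case: xJ => a [b [be ->]]; case: v1i => ->.
    by exists (h + a), b, be; rewrite scalerDl !addrA.
  by exists a, (h + b), be; rewrite scalerDl !addrA; congr (_ + _ + _); rewrite addrC.
rewrite -F0 /F; move: (qi) (1 : quat R) => q u.
rewrite (dirder_add _ (hompoly_add (d u) (hompoly_mull q (d q))) (hompoly_mull J (d J))).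
rewrite (dirder_add _ (d u) (hompoly_mull q (d q))).
rewrite (dirder_mull _ _ (d q)) (dirder_mull _ _ (d J)).
by rewrite (dirder_comm v u fP) (dirder_comm v q fP) (dirder_comm v J fP).
Qed.

Lemma span_decomp x : exists J, sphere1 J /\
  exists be, x = qx0 x *: 1 + qx1 x *: qi + be *: J.
Proof.
suff [b [c [be [bc [E2 E3]]]]] : exists b c be : R, b ^+ 2 + c ^+ 2 = 1 /\
    (qx2 x = be * b /\ qx3 x = be * c).
  exists (b *: qj + c *: qk); split; first by exists b, c.
  exists be; apply: qxP; rewrite !qxE ?E2 ?E3; ring.
pose r := Num.sqrt (qx2 x ^+ 2 + qx3 x ^+ 2).
have rr : r ^+ 2 = qx2 x ^+ 2 + qx3 x ^+ 2.
  by rewrite sqr_sqrtr // addr_ge0 ?sqr_ge0.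
have [r0|r0] := eqVneq r 0.
  exists 1, 0, 0; rewrite expr1n expr0n addr0 !mul0r; split=> //.
  move: rr; rewrite r0 expr0n => /esym/eqP.
  by rewrite paddr_eq0 ?sqr_ge0 // !sqrf_eq0 => /andP[/eqP -> /eqP ->].
exists (qx2 x / r), (qx3 x / r), r; rewrite !exprMn -mulrDl -rr -exprMn divff // expr1n.
by rewrite !(mulrC r) !divfK.
Qed.

Lemma hompoly0_const n f x : hompoly n f -> n = 0%N -> f x = f 0.
Proof.
by elim=> {n f} // n f g _ fE _ gE n0; rewrite fE // gE.
Qed.

Lemma delta0_dirder_qi n f a b : hompoly n f ->
  delta0 a b (dirder qi f) = delta0 a.+1 b f.
Proof.
move=> fP; rewrite /delta0 iterSr (funext (@pd1E R)); congr (iter a _ _).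
have lap_comm t p g : hompoly p g ->
    iter t (@laplace01 R) (dirder qi g) = dirder qi (iter t (@laplace01 R) g).
  elim: t p g => [//|t IH] p g gP; rewrite !iterSr.
  have [LgP _ _] := right_linear_laplace gP.
  rewrite -(IH _ _ LgP); congr (iter t _ _).
  have d u := hompoly_dirder u gP; have dd u := hompoly_dirder u (d u).
  rewrite !laplace01E; move: (qi) (1 : quat R) => q u.
  rewrite (dirder_add _ (dd u) (dd q)).
  by rewrite (dirder_comm q u (d u)) (dirder_comm q u gP).
case: (odd b); last exact: lap_comm fP.
have [DfP _ _] := right_linear_dirac fP.
rewrite -[RHS](lap_comm _ _ _ DfP); congr (iter _ _ _).
have d u := hompoly_dirder u fP.
rewrite !dirac01E; move: (qi) (1 : quat R) => q u.
rewrite (dirder_add _ (d u) (hompoly_mull q (d q))) (dirder_mull _ _ (d q)).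
by rewrite (dirder_comm q u fP).
Qed.

(** Once d1 f = 0, both the Laplacian and d0 + i d1 act on f through d0 alone,
    so delta^(0,(0,b)) is the b-th power of d0. *)
Lemma delta0_dirder_1 n f b : hompoly n f -> dirder qi f = (fun=> 0) ->
  delta0 0 b (dirder 1 f) = delta0 0 b.+1 f.
Proof.
move=> fP f0; have d01 : dirder qi (dirder 1 f) = fun=> 0.
  by rewrite (dirder_comm _ _ fP) f0 dirder_cst.
rewrite /delta0 /= uphalf_half; case: (odd b) => /=.
  rewrite -iterS iterSr; congr (iter _ _ _).
  by rewrite laplace01E dirac01E d01 f0 dirder_cst; apply/funext => x; rewrite mulr0.
congr (iter _ _ _).
by rewrite dirac01E f0; apply/funext => x; rewrite mulr0 addr0.
Qed.

(** Both first derivatives along the complex plane satisfy the hypotheses one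
    degree lower; monogenicity and Euler's identity recover Q from them. *)
Lemma delta0_unique m Q : hompoly m Q -> regular13 setT Q ->
  (forall a b, (a + b)%N = m -> delta0 a b Q 0 = 0) -> forall x, Q x = 0.
Proof.
elim: m Q => [|m IH] Q QP reg Q0 x.
  by rewrite (hompoly0_const x QP erefl); exact: (Q0 0%N 0%N).
have d u := hompoly_dirder u QP.
have d1 : dirder qi Q = fun=> 0.
  apply/funext; apply: (IH (dirder qi Q)) => [||a b abm]; first exact: (d qi).
    by apply: regular_dirder QP reg; right.
  by rewrite (delta0_dirder_qi _ _ QP); apply: Q0; rewrite addSn abm.
have d0 : dirder 1 Q = fun=> 0.
  apply/funext; apply: (IH (dirder 1 Q)) => [||a b abm]; first exact: (d 1).
    by apply: regular_dirder QP reg; left.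
  case: a abm => [|a] abm.
    by rewrite (delta0_dirder_1 _ QP d1); apply: Q0; rewrite -abm.
  rewrite -(delta0_dirder_qi _ _ (d 1)) (dirder_comm _ _ QP) d1 dirder_cst.
  by have [p /right_linear_op0 ->] := @right_linear_delta0 R a b.
have [J [SJ [be xE]]] := span_decomp x.
have dJ : dirder J Q x = 0.
  have xJ : span1iJ J x by exists (qx0 x), (qx1 x), be.
  have := (regular_hompolyP QP).1 reg J x SJ xJ.
  rewrite d0 d1 mulr0 !add0r => /(congr1 (fun u => J * u)).
  by rewrite mulr0 mulrA (sphere1_sqr SJ) mulN1r => /eqP; rewrite oppr_eq0 => /eqP.
have := hompoly_euler x QP; rewrite {1}xE !(dirder_dirD _ _ _ QP) !(dirder_dirZ _ _ _ QP).
rewrite d0 d1 dJ !scaler0 !addr0 => /esym/eqP.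
by rewrite scaler_eq0 pnatr_eq0 => /eqP.
Qed.

End Uniqueness.

(** * The basis *)

Section Basis.
Context {R : realType}.
Implicit Types (f g P : quat R -> quat R) (x v J : quat R).

Lemma Umod_hompolyP m f : Umod m f <-> hompoly m f /\
  forall J x, sphere1 J -> span1iJ J x ->
    dirder 1 f x + qi * dirder qi f x + J * dirder J f x = 0.
Proof.
split=> [[reg /homogeneous_polyP fP]|[fP reg]].
  by split=> //; exact/(regular_hompolyP fP).
by split; [exact/(regular_hompolyP fP)|exact/homogeneous_polyP].
Qed.

Lemma Umod_submodule m : right_submodule (@Umod R m).
Proof.
split=> [|f g|f c].
- apply/Umod_hompolyP; split=> [|J x _ _]; first exact: hompoly_zero.
  by rewrite !dirder_cst !mulr0 !addr0.
- move=> /Umod_hompolyP[fP fr] /Umod_hompolyP[gP gr]; apply/Umod_hompolyP.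
  split=> [|J x SJ xJ]; first exact: hompoly_add.
  rewrite !(dirder_add _ fP gP) !mulrDr.
  by rewrite (addrACA (dirder 1 f x)) (addrACA (_ + _)) fr // gr // addr0.
- move=> /Umod_hompolyP[fP fr]; apply/Umod_hompolyP.
  split=> [|J x SJ xJ]; first exact: hompoly_mulr.
  by rewrite !(dirder_mulr _ _ fP) !mulrA -!mulrDl fr // mul0r.
Qed.

Lemma ind_sum m (k : index2 m) : (ind1 k + ind2 k)%N = m.
Proof. exact/eqP/(valP k). Qed.

Lemma index2_ex m a b : (a + b)%N = m -> exists k : index2 m, ind1 k = a /\ ind2 k = b.
Proof.
move=> abm; have am : (a < m.+1)%N by rewrite ltnS -abm leq_addr.
have bm : (b < m.+1)%N by rewrite ltnS -abm leq_addl.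
have abP : (Ordinal am + Ordinal bm == m)%N by apply/eqP.
by exists (exist _ (Ordinal am, Ordinal bm) abP).
Qed.

Lemma index2_inj m (k l : index2 m) : ind1 k = ind1 l -> k = l.
Proof.
move=> kl; apply: val_inj.
have kl2 : ind2 k = ind2 l by apply: (@addnI (ind1 k)); rewrite ind_sum kl ind_sum.
case: k l kl kl2 => [[k1 k2] ?] [[l1 l2] ?] /= kl kl2.
by congr (_, _); apply: val_inj.
Qed.

Lemma TfamE m (k : index2 m) : Tfam k = Ttw 1 (ind1 k) (ind2 k) :> (quat R -> quat R).
Proof. by apply/funext => x; rewrite /Tfam /T Tnat_Ttw. Qed.

Lemma hompoly_Tfam m (k : index2 m) : hompoly m (@Tfam R m k).
Proof. by rewrite TfamE -[X in hompoly X](ind_sum k); exact: hompoly_Ttw. Qed.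

Lemma Umod_Tfam m (k : index2 m) : Umod m (@Tfam R m k).
Proof.
apply/Umod_hompolyP; split; first exact: hompoly_Tfam.
by move=> J x SJ xJ; rewrite TfamE; exact: Ttw_monogenic.
Qed.

Lemma Umod_comb m (c : index2 m -> quat R) : Umod m (fun x => \sum_k Tfam k x * c k).
Proof.
have [U0 UD UZ] := Umod_submodule m.
suff H (r : seq (index2 m)) : Umod m (fun x => \sum_(k <- r) Tfam k x * c k) by exact: H.
elim: r => [|k r IH].
  by rewrite (_ : (fun=> _) = fun=> 0) //; apply/funext => x; rewrite big_nil.
rewrite (_ : (fun=> _) = fun x => Tfam k x * c k + \sum_(l <- r) Tfam l x * c l).
  by apply: UD => //; apply: UZ; exact: Umod_Tfam.
by apply/funext => x; rewrite big_cons.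
Qed.

Lemma delta0_Tfam m (k l : index2 m) : delta0 (ind1 k) (ind2 k) (@Tfam R m l) 0 =
  if l == k then ((ind1 k)`! * (ind2 k)`!)%N%:R%:A else 0.
Proof.
rewrite TfamE delta0_Ttw; case: eqVneq => [->|lk].
  by rewrite !ffactnn !subnn Ttw00 mulnC.
have [lk1|kl1|kl1] := ltngtP (ind1 l) (ind1 k).
- by rewrite (ffact_small lk1) muln0 scale0r.
- have kl2 : (ind2 l < ind2 k)%N.
    by rewrite -(ltn_add2l (ind1 k)) ind_sum -[X in (_ < X)%N](ind_sum l) ltn_add2r.
  by rewrite (ffact_small kl2) scale0r.
- by move/index2_inj: kl1 lk => ->; rewrite eqxx.
Qed.

Lemma coefT_comb m (c : index2 m -> quat R) k :
  coefT (fun x => \sum_l Tfam l x * c l) (ind1 k) (ind2 k) = c k.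
Proof.
rewrite /coefT (delta0_sum _ _ _ _ (@hompoly_Tfam m)) (bigD1 k) //= big1 => [|l lk].
  rewrite delta0_Tfam eqxx addr0 -scalerAl mul1r scalerA mulVf ?scale1r //.
by rewrite delta0_Tfam (negPf lk) mul0r.
Qed.

Lemma Umod_expansion m P : Umod m P ->
  forall x, P x = \sum_(k : index2 m) Tfam k x * coefT P (ind1 k) (ind2 k).
Proof.
move=> UP x; pose S x := \sum_(k : index2 m) Tfam k x * coefT P (ind1 k) (ind2 k).
have [_ UD UZ] := Umod_submodule m.
have US : Umod m S by exact: Umod_comb.
have UQ := UD _ _ UP (UZ _ (-1) US).
have [Qreg /homogeneous_polyP QP] := UQ.
have [_ /homogeneous_polyP PP] := UP; have [_ /homogeneous_polyP SP] := US.
suff /(_ x) : forall x, P x + S x * -1 = 0.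
  by rewrite mulrN mulr1 => /eqP; rewrite subr_eq0 => /eqP.
apply: (delta0_unique QP Qreg) => a b /index2_ex[k [<- <-]].
have [d dL] := @right_linear_delta0 R (ind1 k) (ind2 k).
have [_ D _] := dL _ _ PP; have [_ _ Z] := dL _ _ SP.
rewrite D ?Z; last exact: hompoly_mulr.
have := coefT_comb (fun k : index2 m => coefT P (ind1 k) (ind2 k)) k.
rewrite -/S /coefT => /(scalerI _) ->; first by rewrite mulrN mulr1 subrr.
by rewrite invr_eq0 pnatr_eq0 -lt0n muln_gt0 !fact_gt0.
Qed.

End Basis.

(** * Slice preservation *)

Section SlicePreserving.
Context {R : realType}.
Implicit Types (x J q : quat R).

Lemma span1iJ_add J p q : span1iJ J p -> span1iJ J q -> span1iJ J (p + q).
Proof.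
move=> [a [b [e ->]]] [a' [b' [e' ->]]]; exists (a + a'), (b + b'), (e + e').
by rewrite (addrACA (_ + _)) (addrACA a%:A) !scalerDl.
Qed.

Lemma span1iJ_0 J : span1iJ J 0.
Proof. by exists 0, 0, 0; rewrite !scale0r !addr0. Qed.

Lemma span1iJ_mul_real J q c : span1iJ J q -> real_line c -> span1iJ J (q * c).
Proof.
move=> [a [b [e ->]]] [r ->]; exists (r * a), (r * b), (r * e).
by rewrite -scalerAr mulr1 !scalerDr !scalerA.
Qed.

Lemma complex_plane_span J q : complex_plane q -> span1iJ J q.
Proof. by move=> [a [b ->]]; exists a, b, 0; rewrite scale0r addr0. Qed.

Lemma complex_plane_mul p q : complex_plane p -> complex_plane q -> complex_plane (p * q).
Proof.
move=> [a [b ->]] [c [d ->]]; exists (a * c - b * d), (a * d + b * c).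
by apply: qxP; rewrite !qxE; ring.
Qed.

Lemma comm_qi_complex q : qi * q = q * qi -> complex_plane q.
Proof.
move=> qC; exists (qx0 q), (qx1 q).
have := congr1 (@qx2 R) qC; have := congr1 (@qx3 R) qC; rewrite !qxE.
rewrite !(mul0r, mulr0, mul1r, mulr1, add0r, addr0, subr0, sub0r, oppr0) => q2 q3.
have E (a : R) : a = - a -> a = 0.
  by move=> /eqP; rewrite -addr_eq0 -mulr2n mulrn_eq0 /= => /eqP.
have {}q2 := E _ q2; have {}q3 := E _ (esym q3).
by apply: qxP; rewrite !qxE ?q2 ?q3; ring.
Qed.

(** On the span of j and k the map v |-> J v J is the reflection v - 2 <v, J> J,
    while it maps the complex plane to itself; so the component of q + J q J along
    j and k is twice the part of q orthogonal to J. *)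
Lemma span1iJ_reflect J q : sphere1 J -> complex_plane (q + J * q * J) -> span1iJ J q.
Proof.
move=> [b [c [bc JE]]] [a0 [a1 E]].
exists (qx0 q), (qx1 q), (b * qx2 q + c * qx3 q).
have half (t u : R) : (u - t) *+ 2 = 0 -> u = t.
  by move/eqP; rewrite mulrn_eq0 /= subr_eq0 => /eqP.
have E2 : qx2 q = (b * qx2 q + c * qx3 q) * b.
  apply: half; transitivity (qx2 (q + J * q * J) + (1 - (b ^+ 2 + c ^+ 2)) * qx2 q).
    by rewrite JE !qxE; ring.
  by rewrite E bc !qxE; ring.
have E3 : qx3 q = (b * qx2 q + c * qx3 q) * c.
  apply: half; transitivity (qx3 (q + J * q * J) + (1 - (b ^+ 2 + c ^+ 2)) * qx3 q).
    by rewrite JE !qxE; ring.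
  by rewrite E bc !qxE; ring.
rewrite JE; apply: qxP; rewrite !qxE; [ring | ring | rewrite {1}E2; ring | rewrite {1}E3; ring].
Qed.

Lemma Ttw0_span k2 x J : sphere1 J -> span1iJ J x -> span1iJ J (Ttw 1 0 k2 x).
Proof.
move=> SJ xJ; have [a [e wE]] := wvar_span xJ SJ.
suff [a' [e' ->]] : exists a' e' : R, Ttw 1 0 k2 x = a'%:A + e' *: J.
  by exists a', 0, e'; rewrite scale0r addr0.
elim: k2 => [|k2 [a' [e' IH]]]; first by exists 1, 0; rewrite scale0r addr0 scale1r.
exists (a' * a - e' * e), (a' * e + e' * a).
have := Ttw_recE 1 0 k2.+1 x; rewrite add0n scale0r add0r /=.
move/(Ttw_cancel (ltn0Sn k2)) ->; rewrite IH wE.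
rewrite mulrDl !mulrDr !quat_scale_mull !quat_scale_mulr !mul1r mulr1 (sphere1_sqr SJ).
by apply/rowP => l; rewrite !(coordD, coordN, coordZ); ring.
Qed.

(** For k2 even the right-hand side of Ttw_flip at (k1, k2 + 1) is a multiple of
    i V + V i, which is complex for every quaternion V. *)
Lemma Ttw_even_span k1 k2 x J : ~~ odd k2 -> sphere1 J -> span1iJ J x ->
  span1iJ J (Ttw 1 k1 k2 x).
Proof.
move=> ek SJ xJ; apply: (span1iJ_reflect SJ).
have -> : J * Ttw 1 k1 k2 x * J = - Ttw (- 1) k1 k2 x.
  by rewrite -mulrA (Ttw_mulJ _ _ _ SJ xJ) mulrA (sphere1_sqr SJ) mulN1r.
have := Ttw_flip 1 k1 k2.+1 x; rewrite /= exprS mulN1r -signr_odd (negPf ek) expr0.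
rewrite scaleN1r opprK mulr1; set V := Ttw 1 k1.-1 k2.+1 x => E.
exists (k2.+1%:R^-1 * (k1%:R * (qx1 V *+ 2))), (k2.+1%:R^-1 * (- k1%:R * (qx0 V *+ 2))).
apply: (Ttw_cancel (ltn0Sn k2)); rewrite E.
rewrite [RHS]scalerDr !scalerA !mulVKf ?pnatr_eq0 //.
by apply: qxP; rewrite !qxE; ring.
Qed.

End SlicePreserving.

Theorem theorem4p7 (R : realType) (m : nat) :
  [/\ right_basis (@Umod R m) (@Tfam R m),
      (forall P : quat R -> quat R, Umod m P ->
         forall x, P x = \sum_(k : index2 m) Tfam k x * coefT P (ind1 k) (ind2 k))
    & (forall P : quat R -> quat R, Umod m P ->
         (forall k1 k2 : nat, (k1 + k2)%N = m ->
            [/\ k2 = 0%N -> complex_plane (coefT P k1 k2),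
                (k1 = 0%N /\ k2 <> 0%N) \/ (k1 <> 0%N /\ k2 <> 0%N /\ ~~ odd k2) ->
                  real_line (coefT P k1 k2)
              & k1 <> 0%N /\ odd k2 -> coefT P k1 k2 = 0]) ->
         slice_preserving13 setT P)].
Proof.
split; last 1 first.
- move=> P UP Pc; split; first by case: UP.
  move=> J SJ _ [x [_ xJ] <-]; rewrite (Umod_expansion UP).
  apply: big_ind => [||k _]; [exact: span1iJ_0|exact: span1iJ_add|].
  have [cC cR c0] := Pc _ _ (ind_sum k); rewrite TfamE.
  move: (ind1 k) (ind2 k) cC cR c0 => k1 k2 cC cR c0.
  have [k20|/eqP k20] := eqVneq k2 0%N.
    apply/complex_plane_span/complex_plane_mul; last exact: cC.
    by rewrite k20; apply: comm_qi_complex; exact: Ttw_comm_qi.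
  have [k10|/eqP k10] := eqVneq k1 0%N.
    apply: span1iJ_mul_real; last by apply: cR; left.
    by rewrite k10; exact: Ttw0_span.
  have [ok|ek] := boolP (odd k2); first by rewrite c0 // mulr0; exact: span1iJ_0.
  apply: span1iJ_mul_real; last by apply: cR; right.
  exact: Ttw_even_span.
- split; [exact: Umod_submodule|exact: Umod_Tfam| |].
    move=> c c0 k; rewrite -(coefT_comb c k) /coefT.
    have [d /right_linear_op0 d0] := @right_linear_delta0 R (ind1 k) (ind2 k).
    by rewrite (funext c0) d0 scaler0.
  by move=> f Uf; exists (fun k => coefT f (ind1 k) (ind2 k)); exact: Umod_expansion.
- exact: Umod_expansion.
Qed.
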